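(* Let $(U,A)$ be a left Hopf algebroid such that $U$ is finitely generated projective as a right $A$-module via $u\cdot a=t(a)u$. (i) Let $M$ be a right $U$-contramodule and $N$ a left $U$-comodule. Then $M\otimes_AN$ is a right $U$-contramodule again. (ii) Let $M$ be an anti Yetter-Drinfel'd contramodule over $U$ and $N$ a Yetter-Drinfel'd module over $U$ (i.e. $N\in{}^U_U\mathbf{YD}$). Then $M\otimes_AN$ with its diagonal left $U$-action is an anti Yetter-Drinfel'd contramodule again.
   Context: $k$ is a commutative ring, algebras are unital associative $k$-algebras, $\otimes=\otimes_k$. Left bialgebroid $(U,A)$: a $k$-algebra $U$ with $k$-algebra maps $s:A\to U$, $t:A^{\mathrm{op}}\to U$ with commuting images, and an $A$-coring structure $\Delta:U\to U\otimes_AU$, $u\mapsto u_{(1)}\otimes_Au_{(2)}$, $\varepsilon:U\to A$, on $U$ with bimodule structure $a\cdot u\cdot b=s(a)t(b)u$, where $U\otimes_AU=U\otimes U/\langle t(a)u\otimes v-u\otimes s(a)v\rangle$. One requires that $\Delta$ takes values in $\{\sum u_i\otimes_A u_i'\mid\sum u_it(a)\otimes u'_i=\sum u_i\otimes u'_is(a)\ \forall a\}$ and is a unital algebra map into it, $\varepsilon(1)=1$, $\varepsilon(uv)=\varepsilon(us(\varepsilon(v)))=\varepsilon(ut(\varepsilon(v)))$. Left Hopf algebroid: $U\otimes_{A^{\mathrm{op}}}U\to U\otimes_AU$, $u\otimes v\mapsto u_{(1)}\otimes u_{(2)}v$, is bijective, where $U\otimes_{A^{\mathrm{op}}}U=U\otimes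 U/\langle ut(a)\otimes v-u\otimes t(a)v\rangle$; $u_+\otimes u_-$ is the preimage of $u\otimes_A1$. Left $U$-modules are $A$-bimodules by $anb=s(a)t(b)n$. The diagonal left $U$-action on a tensor product over $A$ is $u(m\otimes_An)=u_{(1)}m\otimes_Au_{(2)}n$. Left $U$-comodule: a left $A$-module $N$ with a coassociative counital left $A$-linear coaction $n\mapsto n_{(-1)}\otimes_An_{(0)}\in U\otimes_AN$ (with $t(a)u\otimes n=u\otimes an$), and right $A$-action $na:=\varepsilon(n_{(-1)}s(a))n_{(0)}$. Right $U$-contramodule: a right $A$-module $M$ with a map (contraaction) $\gamma:\mathrm{Hom}_{A^{\mathrm{op}}}(U,M)=\{f\mid f(t(a)u)=f(u)a\}\to M$ such that $\gamma(f(s(a)-))=\gamma(f)a$; $\gamma(u\mapsto\gamma(v\mapsto g(u\otimes v)))=\gamma(u\mapsto g(u_{(1)}\otimes u_{(2)}))$ for all $g:U\otimes_AU\to M$ with $g(u\otimes t(a)v)=g(u\otimes v)a$; $\gamma(m\varepsilon(-))=m$. It has the left $A$-action $am:=\gamma(m\varepsilon(-\,s(a)))$. The right $A$-action on $M\otimes_AN$ is $(m\otimes n)a=m\otimes na$. ${}^U_U\mathbf{YD}$: left $U$-module left $U$-comodules $N$ whose $A$-bimodule structures coincide, with $(u_{(1)}n)_{(-1)}u_{(2)}\otimes_A(u_{(1)}n)_{(0)}=u_{(1)}n_{(-1)}\otimes_Au_{(2)}n_{(0)}$. Anti Yetter-Drinfel'd (aYD) contramodule: left $U$-module right $U$-contramodule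 $M$ whose $A$-bimodule structures coincide, with $u(\gamma(f))=\gamma\big(w\mapsto u_{+(2)}f(u_-wu_{+(1)})\big)$ for all $u\in U$, $f\in\mathrm{Hom}_{A^{\mathrm{op}}}(U,M)$. *)

(* Defs.v *)
From HB Require Import structures.
From mathcomp Require Import all_boot all_order all_algebra.
From mathcomp Require Import generic_quotient ring_quotient.
From mathcomp.multinomials Require Import freeg.
From mathcomp Require Import boolp classical_sets.

Set Implicit Arguments.
Unset Strict Implicit.
Unset Printing Implicit Defensive.
Set Warnings "-notation-overridden".

Import GRing.Theory.

Local Open Scope ring_scope.
Local Open Scope quotient_scope.

(** * Balanced tensor products of a right and a left module

    All tensor products below are taken over a k-algebra A (or its opposite)
    acting through k-algebra maps.  Balancing over A entails balancing over k,
    so the quotients of M ⊗_k N are constructed directly from the free abelian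
    group on M × N.  The actions are explicit functions because several
    A-actions live on the same abelian group (U carries four). *)
Section Tensor.
Variables (A : Type) (M N : zmodType) (ra : M -> A -> M) (la : A -> N -> N).

Local Notation F := {freeg (M * N)%type / int}.
Local Notation "'gen' m n" := (<< (m, n) >> : F) (at level 10, m, n at level 9).

Variant tens_gen : F -> Prop :=
| TensAddl m m' n : tens_gen (gen (m + m') n - (gen m n + gen m' n))
| TensAddr m n n' : tens_gen (gen m (n + n') - (gen m n + gen m n'))
| TensBal m a n : tens_gen (gen (ra m a) n - gen m (la a n)).

(** the subgroup generated by [tens_gen] *)
Definition tens_rel : {pred F} := fun x =>
  `[< forall S : zmodClosed F, (forall y, tens_gen y -> y \in S) -> x \in S >].

Fact tens_rel_closed : zmod_closed tens_rel.
Proof.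
split=> [|x y /asboolP xP /asboolP yP]; apply/asboolP => S SP.
  exact: rpred0.
by rewrite rpredB ?xP ?yP.
Qed.

HB.instance Definition _ := GRing.isZmodClosed.Build F tens_rel tens_rel_closed.

Definition tensor : Type := Quotient.quot tens_rel.
HB.instance Definition _ := GRing.Zmodule.on tensor.
HB.instance Definition _ := Quotient.on tensor.

Definition tens (m : M) (n : N) : tensor := \pi_tensor (gen m n).

Definition balanced (V : zmodType) (b : M -> N -> V) : Prop :=
  [/\ forall n, {morph b^~ n : m m' / m + m'},
      forall m, {morph b m : n n' / n + n'}
    & forall m a n, b (ra m a) n = b m (la a n)].

(** [tlift b x] is Σ b m_i n_i for a representative Σ m_i ⊗ n_i of x: the map
    induced by b when b is balanced (lemma [tlift_tens]).  It serves to write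
    Sweedler notation: u_(1) ⊗ u_(2) ↦ b u_(1) u_(2) is [tlift b (Δ u)]. *)
Definition tlift (V : zmodType) (b : M -> N -> V) (x : tensor) : V :=
  \sum_(p <- dom (repr x : F)) b p.1 p.2 *~ coeff p (repr x : F).

Lemma tens_balanced : balanced tens.
Proof.
have E (x y : F) : tens_gen (x - y) ->
    \pi_tensor x = \pi_tensor y.
  move=> g; apply/eqP; rewrite -Quotient.idealrBE.
  by apply/asboolP => S; apply.
split=> [n m m'|m n n'|m a n]; rewrite /tens.
- by rewrite -[RHS]raddfD; apply: E; constructor.
- by rewrite -[RHS]raddfD; apply: E; constructor.
- by apply: E; constructor.
Qed.

Section Lift.
Variables (V : zmodType) (b : M -> N -> V).
Hypothesis bP : balanced b.

Let bZ (p : M * N) : ssrint.zmodule V := b p.1 p.2.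

HB.instance Definition _ := GRing.isZmodMorphism.Build F (ssrint.zmodule V)
  (fglift bZ) (@lift_is_additive _ _ _ bZ).

Let tliftE x : tlift b x = fglift bZ (repr x : F).
Proof.
rewrite /tlift -[in RHS](freeg_sumE (repr x : F)) raddf_sum.
by apply: eq_bigr => p _; rewrite /= liftU.
Qed.

Let ker : {pred F} := fun x => fglift bZ x == 0.
Let ker_closed : zmod_closed ker.
Proof.
split=> [|x y /eqP xP /eqP yP]; apply/eqP; first exact: raddf0.
by rewrite raddfB /= xP yP subrr.
Qed.
HB.instance Definition _ := GRing.isZmodClosed.Build F ker ker_closed.

Let tens_rel_ker x : x \in tens_rel -> fglift bZ x = 0.
Proof.
case: bP => bl br ba.
move=> /asboolP/(_ ker) H; apply/eqP; apply: H => _ [m m' n|m n n'|m a n];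
  apply/eqP; rewrite raddfB ?raddfD /= !liftU !scale1r /bZ /=.
- by rewrite bl -opprD; exact: (@subrr V).
- by rewrite br -opprD; exact: (@subrr V).
- by rewrite ba; exact: (@subrr V).
Qed.

Let tlift_pi x : tlift b (\pi_tensor x) = fglift bZ x.
Proof.
rewrite tliftE; apply/eqP; rewrite -subr_eq0 -raddfB; apply/eqP/tens_rel_ker.
by rewrite Quotient.idealrBE reprK.
Qed.

Lemma tlift_tens m n : tlift b (tens m n) = b m n.
Proof. by rewrite tlift_pi liftU scale1r. Qed.

Lemma tliftD : {morph tlift b : x y / x + y}.
Proof.
move=> x y; rewrite -[x in LHS]reprK -[y in LHS]reprK.
by rewrite -raddfD tlift_pi raddfD /= -!tliftE.
Qed.

End Lift.

Lemma tensor_ind (P : tensor -> Prop) :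
  (forall m n, P (tens m n)) -> (forall x y, P x -> P y -> P (x - y)) ->
  forall x, P x.
Proof.
move=> Pt PB x; rewrite -[x]reprK; move: (repr x : F) => y.
have P0 : P 0 by rewrite -(subrr (tens 0 0)); apply: PB.
have PN z : P z -> P (- z) by rewrite -(sub0r z); apply: PB.
have PD z w : P z -> P w -> P (z + w) by rewrite -{2}(opprK w) => ? /PN; apply: PB.
rewrite -(freeg_sumE y) raddf_sum; apply: (big_ind P) => // -[m n] _ /=.
have -> : << coeff (m, n) y *g (m, n) >> = gen m n *~ coeff (m, n) y.
  by rewrite freegU_mulz intz.
have PM k : P (tens m n *+ k).
  by elim: k => [|k IH]; rewrite ?mulr0n ?mulrS //; apply: PD.
rewrite raddfMz; case: (coeff _ _) => k; rewrite ?NegzE ?mulrNz.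
  exact: PM.
exact/PN/PM.
Qed.
End Tensor.

Arguments tensor {A M N} ra la.
Arguments tens {A M N ra la} m n.
Arguments tlift {A M N ra la V} b x.

(** * Modules given by explicit actions *)
Record is_lmodule (R : pzRingType) (V : zmodType) (act : R -> V -> V) : Prop := {
  lmod1 : forall v, act 1 v = v;
  lmodM : forall a b v, act (a * b) v = act a (act b v);
  lmodDl : forall a b v, act (a + b) v = act a v + act b v;
  lmodDr : forall a v w, act a (v + w) = act a v + act a w
}.

Definition is_rmodule (R : pzRingType) (V : zmodType) (act : V -> R -> V) : Prop :=
  is_lmodule (R := R^c) (fun a v => act v a).

(** * Finitely generated projective modules *)
Definition finitely_generated (R : pzRingType) (V : lmodType R) : Prop :=
  exists n (e : 'I_n -> V), forall v, exists c : 'I_n -> R,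
    v = \sum_(i < n) c i *: e i.

Definition projective (R : pzRingType) (V : lmodType R) : Prop :=
  forall (P Q : lmodType R) (g : {linear P -> Q}) (h : {linear V -> Q}),
    (forall q, exists p, g p = q) ->
    exists l : {linear V -> P}, forall v, g (l v) = h v.

(** * Left bialgebroids *)
Section TensorsOverBase.
Variables (A : Type) (U : pzRingType) (s t : A -> U).

(** U ⊗_A N, balanced by t(a)u ⊗ n = u ⊗ an, with its left A-action *)
Definition UtN (N : zmodType) (la : A -> N -> N) : Type :=
  tensor (fun u a => t a * u) la.

Definition UtN_lact (N : zmodType) (la : A -> N -> N) (a : A) (x : UtN la) :
    UtN la :=
  tlift (fun u n => tens (s a * u) n : UtN la) x.

(** U ⊗_A U *)
Definition UtU : Type := UtN (fun a u => s a * u).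

(** U ⊗_{A^op} U, balanced by u t(a) ⊗ v = u ⊗ t(a) v *)
Definition UtopU : Type := tensor (fun u a => u * t a) (fun a v => t a * v).

Definition UtopU_lact (a : A) (x : UtopU) : UtopU :=
  tlift (fun u v => tens (s a * u) v : UtopU) x.

End TensorsOverBase.

Record bialgebroid (k : comPzRingType) (A U : algType k) := Bialgebroid {
  src : {lrmorphism A -> U};
  (* a k-algebra map A^op -> U *)
  tgt : {linear A -> U};
  tgt1 : tgt 1 = 1;
  tgtM : forall a b, tgt (a * b) = tgt b * tgt a;
  src_tgt_comm : forall a b, src a * tgt b = tgt b * src a;
  copr : {additive U -> UtU src tgt};
  counit : {additive U -> A};
  copr_lact : forall a u, copr (src a * u) = UtN_lact src a (copr u);
  copr_ract : forall a u, copr (tgt a * u) =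
    tlift (fun u1 u2 => tens u1 (tgt a * u2) : UtU src tgt) (copr u);
  counit_lact : forall a u, counit (src a * u) = a * counit u;
  counit_ract : forall a u, counit (tgt a * u) = counit u * a;
  (* in U ⊗_A (U ⊗_A U) *)
  copr_assoc : forall u,
    tlift (fun u1 u2 =>
        tlift (fun x y => tens x (tens y u2) :
            UtN tgt (UtN_lact src (t := tgt) (la := fun a u => src a * u)))
          (copr u1))
      (copr u) =
    tlift (fun u1 u2 => tens u1 (copr u2)) (copr u);
  counitl : forall u, tlift (fun u1 u2 => src (counit u1) * u2) (copr u) = u;
  counitr : forall u, tlift (fun u1 u2 => tgt (counit u2) * u1) (copr u) = u;
  copr_takeuchi : forall a u,
    tlift (fun u1 u2 => tens (u1 * tgt a) u2 : UtU src tgt) (copr u) =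
    tlift (fun u1 u2 => tens u1 (u2 * src a) : UtU src tgt) (copr u);
  copr1 : copr 1 = tens 1 1;
  coprM : forall u v, copr (u * v) =
    tlift (fun v1 v2 =>
        tlift (fun u1 u2 => tens (u1 * v1) (u2 * v2) : UtU src tgt) (copr u))
      (copr v);
  counit1 : counit 1 = 1;
  counitM_src : forall u v, counit (u * v) = counit (u * src (counit v));
  counitM_tgt : forall u v, counit (u * v) = counit (u * tgt (counit v))
}.

(** U as a right A-module via u·a = t(a)u, i.e. as a left A^op-module *)
Definition U_right (k : comPzRingType) (A U : algType k) (H : bialgebroid A U) :
  Type := U.

Section Theory.
Variables (k : comPzRingType) (A U : algType k) (H : bialgebroid A U).

Local Notation s := (src H).
Local Notation t := (tgt H).
Local Notation Δ := (copr H).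
Local Notation ε := (counit H).

Local Notation U_right := (U_right H).
HB.instance Definition _ := GRing.Zmodule.on U_right.

Fact U_rightA (a b : A^c) (u : U_right) : t a * (t b * u) = t (a * b) * u.
Proof. by rewrite mulrA -tgtM. Qed.
Fact U_right1 : left_id 1 (fun (a : A^c) (u : U_right) => t a * u : U_right).
Proof. by move=> u; rewrite tgt1 mul1r. Qed.
Fact U_rightDr :
  right_distributive (fun (a : A^c) (u : U_right) => t a * u : U_right) +%R.
Proof. by move=> a u v; rewrite mulrDr. Qed.
Fact U_rightDl (u : U_right) :
  {morph (fun a : A^c => t a * u : U_right) : a b / a + b}.
Proof. by move=> a b; rewrite raddfD mulrDl. Qed.

HB.instance Definition _ := GRing.Zmodule_isLmodule.Build A^c U_right
  U_rightA U_right1 U_rightDr U_rightDl.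

(** ** Left Hopf algebroids *)
Definition galois (x : UtopU t) : UtU s t :=
  tlift (fun u v => tlift (fun u1 u2 => tens u1 (u2 * v) : UtU s t) (Δ u)) x.

Definition left_hopf : Prop := bijective galois.

(** u_+ ⊗ u_-, meaningful under [left_hopf] *)
Definition translation (u : U) : UtopU t :=
  xget 0 [set x | galois x = tens u 1].

(** ** Left comodules *)
Record is_comodule (N : zmodType) (la : A -> N -> N) (lam : N -> UtN t la) :
    Prop := {
  comod_lmod : is_lmodule la;
  coactD : {morph lam : n n' / n + n'};
  coact_lact : forall a n, lam (la a n) = UtN_lact s a (lam n);
  (* in U ⊗_A (U ⊗_A N) *)
  coact_assoc : forall n,
    tlift (fun u n0 =>
        tlift (fun u1 u2 => tens u1 (tens u2 n0) : UtN t (UtN_lact s (t := t) (la := la)))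
          (Δ u))
      (lam n) =
    tlift (fun u n0 => tens u (lam n0)) (lam n);
  coact_counit : forall n, tlift (fun u n0 => la (ε u) n0) (lam n) = n
}.

(** na = ε(n_(-1) s(a)) n_(0) *)
Definition comod_ract (N : zmodType) (la : A -> N -> N) (lam : N -> UtN t la)
    (n : N) (a : A) : N :=
  tlift (fun u n0 => la (ε (u * s a)) n0) (lam n).

(** ** Right contramodules *)
Section Contramodule.
Variables (M : zmodType) (ra : M -> A -> M).

(** f belongs to Hom_{A^op}(U, M) *)
Definition homA (f : U -> M) : Prop :=
  {morph f : u v / u + v} /\ forall a u, f (t a * u) = ra (f u) a.

(** A contraaction is a map on Hom_{A^op}(U, M); it is represented by a
    function [gam] on all of U -> M, of which only the values at f with [homA f]
    are relevant. *)
Record is_contramodule (gam : (U -> M) -> M) : Prop := {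
  contra_rmod : is_rmodule ra;
  contraD : forall f g, homA f -> homA g ->
    gam (fun u => f u + g u) = gam f + gam g;
  contra_ract : forall f a, homA f -> gam (fun u => f (s a * u)) = ra (gam f) a;
  contra_assoc : forall g : {additive UtU s t -> M},
    (forall u v a, g (tens u (t a * v)) = ra (g (tens u v)) a) ->
    gam (fun u => gam (fun v => g (tens u v))) = gam (fun u => g (Δ u));
  contra_counit : forall m, gam (fun u => ra m (ε u)) = m
}.

(** am = γ(m ε(- s(a))) *)
Definition contra_lact (gam : (U -> M) -> M) (a : A) (m : M) : M :=
  gam (fun u => ra m (ε (u * s a))).

End Contramodule.

(** ** Yetter-Drinfel'd modules *)
Record is_YD (N : zmodType) (act : U -> N -> N) (la : A -> N -> N)
    (lam : N -> UtN t la) : Prop := {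
  YD_lmod : is_lmodule act;
  YD_comod : is_comodule lam;
  YD_lact : forall a n, act (s a) n = la a n;
  YD_ract : forall a n, act (t a) n = comod_ract lam n a;
  YD_compat : forall u n,
    tlift (fun u1 u2 =>
        tlift (fun v n0 => tens (v * u2) n0 : UtN t la) (lam (act u1 n)))
      (Δ u) =
    tlift (fun v n0 =>
        tlift (fun u1 u2 => tens (u1 * v) (act u2 n0) : UtN t la) (Δ u))
      (lam n)
}.

(** ** Anti Yetter-Drinfel'd contramodules *)

(** U ⊗_A (U ⊗_{A^op} U), where u_{+(1)} ⊗ u_{+(2)} ⊗ u_- lives *)
Definition UtUtopU : Type := UtN t (@UtopU_lact A U s t).

Definition translation_copr (u : U) : UtUtopU :=
  tlift (fun up um =>
      tlift (fun up1 up2 => tens up1 (tens up2 um : UtopU t) : UtUtopU) (Δ up))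
    (translation u).

(** Σ t(a) y_i ⊗ z_i = Σ y_i ⊗ z_i t(a) in U ⊗_{A^op} U; the elements
    u_+ ⊗ u_- have this property. *)
Definition takeuchi_op (x : UtopU t) : Prop := forall a : A,
  tlift (fun y z => tens (t a * y) z : UtopU t) x =
  tlift (fun y z => tens y (z * t a) : UtopU t) x.

(** In u γ(f) = γ(w ↦ u_{+(2)} f(u_- w u_{+(1)})), replacing t(a)x ⊗ y by
    x ⊗ s(a)y in u_{+(1)} ⊗ u_{+(2)} changes the function of w, but not the
    value of γ on it, since γ(f(- t(a))) = γ(a f(-)).  For the function to lie
    in Hom_{A^op}(U, M), the tensor has to be written as a sum Σ_j x_j ⊗ v_j
    with v_j in U ⊗_{A^op} U satisfying [takeuchi_op], such as
    u_{(1)} ⊗ (u_{(2)+} ⊗ u_{(2)-}).  The identity is required for all of these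
    expressions. *)
Record is_aYD_contramodule (M : zmodType) (act : U -> M -> M) (ra : M -> A -> M)
    (gam : (U -> M) -> M) : Prop := {
  aYD_lmod : is_lmodule act;
  aYD_contra : is_contramodule ra gam;
  aYD_lact : forall a m, act (s a) m = contra_lact ra gam a m;
  aYD_ract : forall a m, act (t a) m = ra m a;
  aYD_compat : forall (u : U) (f : U -> M) (c : seq (U * UtopU t)),
    homA ra f ->
    {in c, forall p, takeuchi_op p.2} ->
    translation_copr u = \sum_(p <- c) tens p.1 p.2 ->
    act u (gam f) =
    gam (fun w => \sum_(p <- c) tlift (fun y z => act y (f (z * w * p.1))) p.2)
}.

(** ** The structures on M ⊗_A N *)
Section MtN.
Variables (M N : zmodType) (ra : M -> A -> M) (la : A -> N -> N).
Variables (gam : (U -> M) -> M) (lam : N -> UtN t la).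

Definition MtN_ract (x : tensor ra la) (a : A) : tensor ra la :=
  tlift (fun m n => tens m (comod_ract lam n a)) x.

Definition MtN_act (actM : U -> M -> M) (actN : U -> N -> N) (u : U)
    (x : tensor ra la) : tensor ra la :=
  tlift (fun m n => tlift (fun u1 u2 => tens (actM u1 m) (actN u2 n)) (Δ u)) x.

(** The contraaction γ' on M ⊗_A N is determined by
      γ'(u ↦ g(n_(-1) u) ⊗ n_(0)) = γ(g) ⊗ n:
    if U is a left Hopf algebroid and finitely generated projective via t,
    then g ⊗ n ↦ (u ↦ g(n_(-1) u) ⊗ n_(0)) is a bijection from
    Hom_{A^op}(U, M) ⊗_A N to Hom_{A^op}(U, M ⊗_A N).  For a Hopf algebra with
    antipode S, γ' sends u ↦ f(u) ⊗ n to γ(u ↦ f(S(n_(-1)) u)) ⊗ n_(0). *)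
Definition is_tensor_contraaction (gam' : (U -> tensor ra la) -> tensor ra la) :
    Prop :=
  forall (g : U -> M) (n : N), homA ra g ->
    gam' (fun u => tlift (fun v n0 => tens (g (v * u)) n0) (lam n)) =
    tens (gam g) n.

End MtN.
End Theory.

Arguments galois {k A U} H x.
Arguments is_comodule {k A U} H {N la} lam.
Arguments is_contramodule {k A U} H {M} ra gam.
Arguments is_YD {k A U} H {N} act {la} lam.
Arguments is_aYD_contramodule {k A U} H {M} act ra gam.
Arguments is_tensor_contraaction {k A U} H {M N ra la} gam lam gam'.
Arguments MtN_ract {k A U} H {M N ra la} lam x a.
Arguments MtN_act {k A U} H {M N ra la} actM actN u x.

(* Main.v *)
From HB Require Import structures.
Require Import Defs.
From mathcomp Require Import all_boot all_algebra.
From mathcomp.multinomials Require Import freeg.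
From mathcomp Require Import boolp classical_sets.

Set Implicit Arguments.
Unset Strict Implicit.
Unset Printing Implicit Defensive.

Import GRing.Theory.
Local Open Scope ring_scope.

(** Let [e i], [φ i] be a dual basis of U as a right A-module, so that
    u = Σ t(φ_i(u)) e_i.  For an A^op-linear form φ on U, the form
    K_φ(x, v) = ε(x_+ s(φ(x_- v))) plays the role of φ(S(x)v), which makes
    sense only in the presence of an antipode.  It has two cancellation
    properties, K_φ(x_(1), x_(2) v) = ε(x s(φ(v)))  ([antipode_form_copr]) and
    Σ_i t(K_{φ_i}(x_(2), v)) x_(1) e_i = s(ε(x)) v  ([antipode_form_basis]);
    both come from the standard identities for u_+ ⊗ u_-.

    For g in Hom_{A^op}(U, M) and n in N, let Φ(g, n) be the map
    u ↦ g(n_(-1) u) ⊗ n_(0) from U to M ⊗_A N ([coact_hom]).  By the first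
    cancellation property, m ⊗ n φ_i(u) = m K_{φ_i}(n_(-2), n_(-1) u) ⊗ n_(0);
    since any f in Hom_{A^op}(U, M ⊗_A N) is Σ_i f(e_i) φ_i(-), it is a finite
    sum of maps Φ(g, n) ([MtN_hom_ind]).  The contraaction is
    γ'(f) = Σ_i γ(v ↦ m K_{φ_i}(n_(-1), v)) ⊗ n_(0), where f(e_i) = m ⊗ n
    ([tensor_contra]).  By the second cancellation property it satisfies
    γ'(Φ(g, n)) = γ(g) ⊗ n ([tensor_contraP]).  As γ' is additive, the axioms
    of a contramodule need only be checked on the maps Φ(g, n), where they
    reduce to those of M.

    For the second part, projectivity of U makes the anti Yetter-Drinfel'd
    condition equivalent to
      u γ(f) = γ(w ↦ u_{(2)+} f(u_{(2)-} w u_(1)))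
    ([twisted_contra_copr]).  For f = Φ(g, n), this condition for M ⊗_A N
    follows from that for M by coassociativity and the identity
      y_{(1)+} q(y_{(1)-} (y_(2) n)_(-1)) ⊗ (y_(2) n)_(0)
        = y_{+(1)} q(n_(-1) y_-) ⊗ y_{+(2)} n_(0)
    for q in Hom_{A^op}(U, M) ([twisted_YD]), a consequence of the
    Yetter-Drinfel'd condition for N. *)

(** * Sums over the terms of a tensor *)

(** Sweedler notation: \sw_(u, v <- x) E is Σ E(u_i, v_i) for the chosen
    representative Σ u_i ⊗ v_i of x.  It is additive in E without any
    hypothesis; balancedness of E is needed only to evaluate it on m ⊗ n and to
    make it additive in x. *)
Reserved Notation "\sw_ ( u , v <- x ) E"
  (at level 41, E at level 41, u name, v name, x at level 200,
   format "'[' \sw_ ( u ,  v  <-  x ) '/  '  E ']'").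
Local Notation "\sw_ ( u , v <- x ) E" := (tlift (fun u v => E) x).

Section AdditiveMaps.
Variables (V W : zmodType) (f : V -> W).
Hypothesis fD : {morph f : x y / x + y}.

Lemma morphD0 : f 0 = 0.
Proof. by apply: (@addrI _ (f 0)); rewrite -fD !addr0. Qed.

Lemma morphDN x : f (- x) = - f x.
Proof. by apply/eqP; rewrite -addr_eq0 -fD addNr morphD0. Qed.

Lemma morphDB : {morph f : x y / x - y}.
Proof. by move=> x y; rewrite fD morphDN. Qed.

Lemma morphD_sum I (r : seq I) (F : I -> V) :
  f (\sum_(i <- r) F i) = \sum_(i <- r) f (F i).
Proof. exact: (big_morph f fD morphD0). Qed.

End AdditiveMaps.

Section SweedlerSums.
Variables (A : Type) (M N : zmodType) (ra : M -> A -> M) (la : A -> N -> N).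
Implicit Types (x : tensor ra la).

Lemma tensDl m m' n : tens (m + m') n = tens m n + tens m' n :> tensor ra la.
Proof. by case: (tens_balanced ra la) => ->. Qed.

Lemma tensDr m n n' : tens m (n + n') = tens m n + tens m n' :> tensor ra la.
Proof. by case: (tens_balanced ra la) => _ ->. Qed.

Lemma tensA m a n : tens (ra m a) n = tens m (la a n) :> tensor ra la.
Proof. by case: (tens_balanced ra la) => _ _ ->. Qed.

(** Every \sw over x is one and the same finite signed sum, whatever the
    summand.  This reduces the rules for \sw that do not change x to those for
    finite sums. *)
Lemma tlift_signed_sum x : exists l : seq (bool * (M * N)),
  forall (V : zmodType) (b : M -> N -> V),
    \sw_(m, n <- x) b m n =
    \sum_(p <- l) (if p.1 then - b p.2.1 p.2.2 else b p.2.1 p.2.2).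
Proof.
rewrite /tlift; elim: (dom _) => [|p r [l IH]].
  by exists [::] => V b; rewrite !big_nil.
have [z zE] : exists z : int, z = coeff p (repr x) by eexists.
exists (nseq `|z| (z < 0, p) ++ l) => V b; rewrite big_cons IH big_cat /= -zE.
congr (_ + _); rewrite big_nseq iter_addr_0 /=; case: z {zE} => n //=.
by rewrite NegzE mulrNz mulNrn.
Qed.

Lemma eq_tlift (V : zmodType) (b b' : M -> N -> V) x :
  (forall m n, b m n = b' m n) -> \sw_(m, n <- x) b m n = \sw_(m, n <- x) b' m n.
Proof. by move=> E; apply: eq_bigr => p _; rewrite E. Qed.

Lemma tlift_split (V : zmodType) (b b' : M -> N -> V) x :
  \sw_(m, n <- x) (b m n + b' m n) =
  (\sw_(m, n <- x) b m n) + \sw_(m, n <- x) b' m n.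
Proof. by rewrite /tlift -big_split; apply: eq_bigr => p _; rewrite mulrzDl. Qed.

Lemma tlift_sumr (V : zmodType) I (r : seq I) (b : I -> M -> N -> V) x :
  \sw_(m, n <- x) (\sum_(i <- r) b i m n) =
  \sum_(i <- r) \sw_(m, n <- x) b i m n.
Proof.
elim: r => [|i r IH].
  rewrite big_nil /tlift big1 // => p _; rewrite big_nil; exact: mul0rz.
rewrite big_cons -IH -tlift_split; apply: eq_tlift => m n; exact: big_cons.
Qed.

Lemma morph_tlift (V W : zmodType) (f : V -> W) (b : M -> N -> V) x :
  {morph f : y z / y + z} ->
  f (\sw_(m, n <- x) b m n) = \sw_(m, n <- x) f (b m n).
Proof.
move=> fD; have [l E] := tlift_signed_sum x; rewrite !E (morphD_sum fD).
by apply: eq_bigr => p _; case: ifP => // _; rewrite morphDN.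
Qed.

Lemma tlift_id x : \sw_(m, n <- x) tens m n = x.
Proof.
have B := tens_balanced ra la.
elim/tensor_ind: x => [m n|x y Ex Ey]; first exact: tlift_tens.
by rewrite (morphDB (tliftD B)) Ex Ey.
Qed.


Lemma tliftB (V : zmodType) (b : M -> N -> V) : balanced ra la b ->
  {morph @tlift A M N ra la V b : x y / x - y}.
Proof. by move=> bP; apply: morphDB; apply: tliftD. Qed.

Lemma tlift_sum (V : zmodType) (b : M -> N -> V) I (r : seq I)
    (x : I -> tensor ra la) : balanced ra la b ->
  tlift b (\sum_(i <- r) x i) = \sum_(i <- r) tlift b (x i).
Proof. by move=> bP; apply: morphD_sum; apply: tliftD. Qed.

Lemma tens_suml I (r : seq I) (F : I -> M) n :
  tens (\sum_(i <- r) F i) n = \sum_(i <- r) tens (F i) n :> tensor ra la.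
Proof. by apply: (morphD_sum (f := tens^~ n)) => m m'; apply: tensDl. Qed.

Lemma tens_oppl m n : tens (- m) n = - tens m n :> tensor ra la.
Proof. by apply: (morphDN (f := tens^~ n)) => m' m''; apply: tensDl. Qed.

Lemma tensor_sum x : exists l : seq (M * N), x = \sum_(p <- l) tens p.1 p.2.
Proof.
elim/tensor_ind: x => [m n|x y [l ->] [l' ->]].
  by exists [:: (m, n)]; rewrite big_seq1.
exists (l ++ [seq (- p.1, p.2) | p <- l']).
rewrite big_cat big_map -sumrN; congr (_ + _); apply: eq_bigr => p _ /=.
by rewrite tens_oppl.
Qed.

End SweedlerSums.

Section SweedlerSumsOfTwoTensors.
Variables (A : Type) (M N : zmodType) (ra : M -> A -> M) (la : A -> N -> N).
Variables (A' : Type) (M' N' : zmodType) (ra' : M' -> A' -> M')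
  (la' : A' -> N' -> N').

Lemma tlift_tlift (V : zmodType) (b : M -> N -> V)
    (c : M' -> N' -> tensor ra la) (x : tensor ra' la') : balanced ra la b ->
  \sw_(m, n <- \sw_(m', n' <- x) c m' n') b m n =
  \sw_(m', n' <- x) \sw_(m, n <- c m' n') b m n.
Proof. by move=> bP; apply: morph_tlift; apply: tliftD. Qed.

Lemma exchange_tlift (V : zmodType) (b : M -> N -> M' -> N' -> V)
    (x : tensor ra la) (y : tensor ra' la') :
  \sw_(m, n <- x) \sw_(m', n' <- y) b m n m' n' =
  \sw_(m', n' <- y) \sw_(m, n <- x) b m n m' n'.
Proof.
pose F (c : M' -> N' -> V) := \sw_(m', n' <- y) c m' n'.
have [l E] := tlift_signed_sum y; rewrite E.
transitivity (\sw_(m, n <- x) \sum_(p <- l)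
    (if p.1 then - b m n p.2.1 p.2.2 else b m n p.2.1 p.2.2)).
  by apply: eq_tlift => m n; rewrite E.
rewrite tlift_sumr; apply: eq_bigr => -[[] p] _ //=.
by rewrite (@morph_tlift _ _ _ _ _ _ _ -%R) // => v w; rewrite opprD.
Qed.

Lemma tens_tliftl (b : M' -> N' -> M) (y : tensor ra' la') n :
  tens (\sw_(m', n' <- y) b m' n') n =
  \sw_(m', n' <- y) tens (b m' n') n :> tensor ra la.
Proof. by apply: (morph_tlift (f := tens^~ n)) => m m'; apply: tensDl. Qed.

Lemma tens_tliftr (b : M' -> N' -> N) (y : tensor ra' la') m :
  tens m (\sw_(m', n' <- y) b m' n') =
  \sw_(m', n' <- y) tens m (b m' n') :> tensor ra la.
Proof. exact: morph_tlift (tensDr _ _ m). Qed.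

End SweedlerSumsOfTwoTensors.

(** * The coproduct and the translation map *)

Section Bialgebroid.
Variables (k : comPzRingType) (A U : algType k) (H : bialgebroid A U).

Local Notation s := (src H).
Local Notation t := (tgt H).
Local Notation Δ := (copr H).
Local Notation ε := (counit H).
Local Notation lt := (fun (u : U) (a : A) => t a * u).
Local Notation ls := (fun (a : A) (u : U) => s a * u).

(** Maps on U × U × N that are additive in each variable and balanced over A in
    the first two and in the last two, i.e. maps defined on U ⊗_A U ⊗_A N. *)
Definition trilinear (N V : zmodType) (la : A -> N -> N) (T : U -> U -> N -> V) :=
  (forall n, balanced lt ls (fun u v => T u v n)) /\
  (forall u, balanced lt la (T u)).

Lemma balanced_srcl (N V : zmodType) (la : A -> N -> N) (b : U -> N -> V) a :
  balanced lt la b -> balanced lt la (fun u n => b (s a * u) n).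
Proof.
case=> bl br ba; split=> [n u v|u n n'|u c n].
- by rewrite mulrDr bl.
- by rewrite br.
- by rewrite mulrA src_tgt_comm -mulrA ba.
Qed.

Lemma UtN_lact_balanced (N : zmodType) (la : A -> N -> N) a :
  balanced lt la (fun u n => tens (s a * u) n : UtN t la).
Proof. exact/balanced_srcl/tens_balanced. Qed.

Lemma UtN_lact_tlift (N V : zmodType) (la : A -> N -> N) (b : U -> N -> V) a
    (w : UtN t la) : balanced lt la b ->
  \sw_(u, n <- UtN_lact s a w) b u n = \sw_(u, n <- w) b (s a * u) n.
Proof.
move=> bP; rewrite /UtN_lact tlift_tlift //; apply: eq_tlift => u n.
exact: tlift_tens.
Qed.

Lemma UtN_lact_tens (N : zmodType) (la : A -> N -> N) a u n :
  UtN_lact s a (tens u n : UtN t la) = tens (s a * u) n.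
Proof. exact: tlift_tens (UtN_lact_balanced la a) u n. Qed.

(** n_(-1)(1) ⊗ n_(-1)(2) ⊗ n_(0) = n_(-2) ⊗ n_(-1) ⊗ n_(0), in the form in
    which coassociativity is applied below; N = U is allowed ([copr_comod]). *)
Lemma coact_assoc_sw (N V : zmodType) (la : A -> N -> N) (lam : N -> UtN t la)
    (T : U -> U -> N -> V) n : is_comodule H lam -> trilinear la T ->
  \sw_(u, n0 <- lam n) \sw_(u1, u2 <- Δ u) T u1 u2 n0 =
  \sw_(u, n1 <- lam n) \sw_(v, n0 <- lam n1) T u v n0.
Proof.
move=> lamP [T12 T23].
pose B u (w : UtN t la) := \sw_(v, n0 <- w) T u v n0.
have BP : balanced lt (UtN_lact s (t := t) (la := la)) B.
  split=> [w u u'|u|u a w]; rewrite /B.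
  - by rewrite -tlift_split; apply: eq_tlift => v m; case: (T12 m) => ->.
  - by apply: tliftD; apply: T23.
  - rewrite UtN_lact_tlift; last exact: T23.
    by apply: eq_tlift => v m; case: (T12 m) => _ _ ->.
have /(congr1 (tlift B)) := coact_assoc lamP n.
rewrite !tlift_tlift // => E; transitivity (
  \sw_(u, n0 <- lam n) tlift B (\sw_(u1, u2 <- Δ u)
     (tens u1 (tens u2 n0) : UtN t (UtN_lact s (t := t) (la := la))))).
  apply: eq_tlift => u m; rewrite tlift_tlift //; apply: eq_tlift => v w.
  rewrite (tlift_tens BP) /B (@tlift_tens _ _ _ _ _ _ (T v)) //.
rewrite E; apply: eq_tlift => u m; exact: (tlift_tens BP).
Qed.

Lemma coprD : {morph Δ : u v / u + v}.
Proof. exact: raddfD. Qed.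

Lemma srcD : {morph s : a b / a + b}. Proof. exact: raddfD. Qed.
Lemma tgtD : {morph t : a b / a + b}. Proof. exact: raddfD. Qed.
Lemma srcM a b : s (a * b) = s a * s b. Proof. exact: rmorphM. Qed.
Lemma counitD : {morph ε : u v / u + v}. Proof. exact: raddfD. Qed.

(** Rewrite rules expanding sums under s, t, ε and products. *)
Definition linE := (srcD, tgtD, counitD, mulrDl, mulrDr).

Lemma src_lmod : is_lmodule ls.
Proof.
split=> [u|a b u|a b u|a u v]; rewrite ?linE // ?srcM ?mulrA //.
by rewrite rmorph1 mul1r.
Qed.

Lemma copr_comod : is_comodule H (la := ls) Δ.
Proof.
split; [exact: src_lmod | exact: coprD | exact: copr_lact | exact: copr_assoc
       | exact: counitl].
Qed.

Section Coproduct.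
Variables (V : zmodType) (b : U -> U -> V).
Hypothesis bP : balanced lt ls b.

Lemma copr_srcl a u :
  \sw_(u1, u2 <- Δ (s a * u)) b u1 u2 = \sw_(u1, u2 <- Δ u) b (s a * u1) u2.
Proof. by rewrite copr_lact UtN_lact_tlift. Qed.

Lemma copr_tgtl a u :
  \sw_(u1, u2 <- Δ (t a * u)) b u1 u2 = \sw_(u1, u2 <- Δ u) b u1 (t a * u2).
Proof.
rewrite copr_ract tlift_tlift //; apply: eq_tlift => v w; exact: tlift_tens.
Qed.

Lemma copr_takeuchi_sw a u :
  \sw_(u1, u2 <- Δ u) b (u1 * t a) u2 = \sw_(u1, u2 <- Δ u) b u1 (u2 * s a).
Proof.
have /(congr1 (tlift b)) := copr_takeuchi H a u.
rewrite !tlift_tlift // => E.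
transitivity (\sw_(u1, u2 <- Δ u) tlift b (tens (u1 * t a) u2 : UtU s t)).
  by apply: eq_tlift => v w; rewrite tlift_tens.
by rewrite E; apply: eq_tlift => v w; rewrite tlift_tens.
Qed.

Lemma coprM_sw u v :
  \sw_(x, y <- Δ (u * v)) b x y =
  \sw_(v1, v2 <- Δ v) \sw_(u1, u2 <- Δ u) b (u1 * v1) (u2 * v2).
Proof.
rewrite coprM tlift_tlift //; apply: eq_tlift => v1 v2.
rewrite tlift_tlift //; apply: eq_tlift => u1 u2; exact: tlift_tens.
Qed.

Lemma copr1_sw : \sw_(u1, u2 <- Δ 1) b u1 u2 = b 1 1.
Proof. by rewrite copr1 tlift_tens. Qed.

Lemma balanced_mulr x y : balanced lt ls (fun u v => b (u * x) (v * y)).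
Proof.
case: bP => bl br ba; split=> [n u v|u n n'|u a n].
- by rewrite mulrDl bl.
- by rewrite mulrDl br.
- by rewrite -mulrA ba mulrA.
Qed.

Lemma balanced_mulr2 z : balanced lt ls (fun u v => b u (v * z)).
Proof.
case: bP => bl br ba; split=> [n x x'|x n n'|x a n].
- by rewrite bl.
- by rewrite mulrDl br.
- by rewrite ba mulrA.
Qed.

Lemma balanced_tgtl a : balanced lt ls (fun u v => b u (t a * v)).
Proof.
case: bP => bl br ba; split=> [n u v|u n n'|u c n].
- by rewrite bl.
- by rewrite mulrDr br.
- by rewrite ba !mulrA src_tgt_comm.
Qed.

(** Δ(s(a)) = s(a) ⊗ 1 and Δ(t(a)) = 1 ⊗ t(a). *)
Lemma copr_src a : \sw_(x, y <- Δ (s a)) b x y = b (s a) 1.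
Proof.
by rewrite -[s a]mulr1 copr_srcl // copr1 (tlift_tens (balanced_srcl a bP)).
Qed.

Lemma copr_tgt a : \sw_(x, y <- Δ (t a)) b x y = b 1 (t a).
Proof.
by rewrite -[t a]mulr1 copr_tgtl // copr1 (tlift_tens (balanced_tgtl a)).
Qed.

End Coproduct.

Section CoproductOfProduct.
Variables (V : zmodType) (b : U -> U -> V).
Hypothesis bP : balanced lt ls b.

(** Multiplying Δ(u) by x ⊗ y on the right is well defined on U ⊗_A U because
    Δ(u) lies in the Takeuchi product. *)
Lemma balanced_coprM u :
  balanced lt ls (fun x y => \sw_(u1, u2 <- Δ u) b (u1 * x) (u2 * y)).
Proof.
case: (bP) => bl br ba; split=> [y x x'|x y y'|x a y].
- by rewrite -tlift_split; apply: eq_tlift => u1 u2; rewrite mulrDr bl.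
- by rewrite -tlift_split; apply: eq_tlift => u1 u2; rewrite mulrDr br.
- under eq_tlift do rewrite mulrA.
  under [RHS]eq_tlift do rewrite mulrA.
  exact: (copr_takeuchi_sw (balanced_mulr bP x y)).
Qed.

Lemma copr_srcr u a :
  \sw_(x, y <- Δ (u * s a)) b x y = \sw_(u1, u2 <- Δ u) b (u1 * s a) u2.
Proof.
rewrite coprM_sw // (copr_src (balanced_coprM u)).
by apply: eq_tlift => u1 u2; rewrite mulr1.
Qed.

Lemma copr_tgtr u a :
  \sw_(x, y <- Δ (u * t a)) b x y = \sw_(u1, u2 <- Δ u) b u1 (u2 * t a).
Proof.
rewrite coprM_sw // (copr_tgt (balanced_coprM u)).
by apply: eq_tlift => u1 u2; rewrite mulr1.
Qed.

End CoproductOfProduct.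

Lemma counit_src a : ε (s a) = a.
Proof. by rewrite -[s a]mulr1 counit_lact counit1 mulr1. Qed.

Lemma counit_srcr u a : ε (u * s a) = ε (u * t a).
Proof. by rewrite counitM_tgt counit_src. Qed.

Lemma balanced_counitl : balanced lt ls (fun u v => s (ε u) * v).
Proof.
split=> [n u v|u n n'|u a n]; rewrite ?linE //.
by rewrite counit_ract srcM mulrA.
Qed.

Lemma balanced_counitr : balanced lt ls (fun u v => t (ε v) * u).
Proof.
split=> [n u v|u n n'|u a n]; rewrite ?linE //.
by rewrite counit_lact tgtM mulrA.
Qed.

Lemma counit_copr_src u a : \sw_(u1, u2 <- Δ u) s (ε (u1 * s a)) * u2 = u * s a.
Proof. by rewrite -[RHS](counitl H) (copr_srcr balanced_counitl). Qed.

Lemma counit_copr_tgt u a : \sw_(u1, u2 <- Δ u) t (ε (u2 * s a)) * u1 = u * t a.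
Proof.
rewrite -[RHS](counitr H) (copr_tgtr balanced_counitr).
by apply: eq_tlift => u1 u2; rewrite counit_srcr.
Qed.

Section Hopf.
Hypothesis hopfH : left_hopf H.

Local Notation balop b := (balanced (fun u a => u * t a) (fun a v => t a * v) b).
Local Notation τ := (translation H).

Lemma galois_balanced : balop (fun u v =>
  \sw_(u1, u2 <- Δ u) tens u1 (u2 * v) : UtU s t).
Proof.
have bP := tens_balanced lt ls.
have bP' v : balanced lt ls (fun x y => tens x (y * v) : UtU s t).
  by apply: balanced_mulr2; apply: tens_balanced.
split=> [v u u'|u v v'|u a v].
- by rewrite coprD tliftD.
- by rewrite -tlift_split; apply: eq_tlift => x y; rewrite mulrDr tensDr.
- by rewrite copr_tgtr //; apply: eq_tlift => x y; rewrite mulrA.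
Qed.

Lemma galois_tens u v :
  galois H (tens u v) = \sw_(u1, u2 <- Δ u) tens u1 (u2 * v).
Proof. by rewrite /galois (tlift_tens galois_balanced). Qed.

Lemma galoisD : {morph galois H : x y / x + y}.
Proof. exact: tliftD galois_balanced. Qed.

Lemma galois_translation u : galois H (τ u) = tens u 1.
Proof.
case: hopfH => g _ gK; rewrite /translation.
by case: xgetP => [x _ //|/(_ (g (tens u 1)))[]]; apply: gK.
Qed.

Lemma galois_inj : injective (galois H).
Proof. exact: bij_inj. Qed.

(** u_{+(1)} ⊗ u_{+(2)} u_- = u ⊗ 1. *)
Lemma translation_galois (V : zmodType) (b : U -> U -> V) u : balanced lt ls b ->
  \sw_(y, z <- τ u) \sw_(y1, y2 <- Δ y) b y1 (y2 * z) = b u 1.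
Proof.
move=> bP; rewrite -(tlift_tens bP) -galois_translation /galois tlift_tlift //.
apply: eq_tlift => y z; rewrite tlift_tlift //; apply: eq_tlift => y1 y2.
by rewrite tlift_tens.
Qed.

Lemma translationD : {morph τ : u v / u + v}.
Proof.
move=> u v; apply: galois_inj.
by rewrite galoisD !galois_translation tensDl.
Qed.

Lemma translation_src a u : τ (s a * u) = \sw_(y, z <- τ u) tens (s a * y) z.
Proof.
apply: galois_inj; rewrite galois_translation (morph_tlift _ _ galoisD).
have bP := UtN_lact_balanced ls a.
rewrite -(translation_galois u bP); apply: eq_tlift => y z.
rewrite galois_tens copr_srcl //.
by apply: balanced_mulr2; apply: tens_balanced.
Qed.

Lemma translation_tgt a u : τ (t a * u) = \sw_(y, z <- τ u) tens y (z * s a).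
Proof.
apply: galois_inj; rewrite galois_translation (morph_tlift _ _ galoisD).
have bP : balanced lt ls (fun x y => tens x (y * s a) : UtU s t).
  by apply: balanced_mulr2; apply: tens_balanced.
rewrite tensA mulr1 -[s a]mul1r -(translation_galois u bP).
apply: eq_tlift => y z; rewrite galois_tens; apply: eq_tlift => y1 y2.
by rewrite mul1r mulrA.
Qed.

(** t(a) u_+ ⊗ u_- = u_+ ⊗ u_- t(a). *)
Lemma translation_takeuchi u : takeuchi_op (H := H) (τ u).
Proof.
move=> a; apply: galois_inj; rewrite !(morph_tlift _ _ galoisD).
have bP : balanced lt ls (fun x y => tens x (t a * y) : UtU s t).
  exact: balanced_tgtl (tens_balanced lt ls) a.
have bP' : balanced lt ls (fun x y => tens x (y * t a) : UtU s t).
  by apply: balanced_mulr2; apply: tens_balanced.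
transitivity (tens u (t a * 1) : UtU s t).
  rewrite -(translation_galois u bP); apply: eq_tlift => y z.
  rewrite galois_tens copr_tgtl.
    by apply: eq_tlift => y1 y2; rewrite mulrA.
  by apply: balanced_mulr2; apply: tens_balanced.
rewrite mulr1 -[t a]mul1r -(translation_galois u bP'); apply: eq_tlift => y z.
by rewrite galois_tens; apply: eq_tlift => y1 y2; rewrite mul1r mulrA.
Qed.

Lemma takeuchi_op_sw (V : zmodType) (c : U -> U -> V) x a :
  takeuchi_op (H := H) x -> balop c ->
  \sw_(y, z <- x) c (t a * y) z = \sw_(y, z <- x) c y (z * t a).
Proof.
move=> xP cP; have /(congr1 (tlift c)) := xP a; rewrite !tlift_tlift // => E.
transitivity (\sw_(y, z <- x) tlift c (tens (t a * y) z : UtopU t)).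
  by apply: eq_tlift => y z; rewrite tlift_tens.
by rewrite E; apply: eq_tlift => y z; rewrite tlift_tens.
Qed.

(** u_{(1)+} ⊗ u_{(1)-} u_(2) = u ⊗ 1. *)
Lemma copr_translation (V : zmodType) (c : U -> U -> V) u : balop c ->
  \sw_(u1, u2 <- Δ u) \sw_(y, z <- τ u1) c y (z * u2) = c u 1.
Proof.
move=> cP; have E : \sw_(u1, u2 <- Δ u) \sw_(y, z <- τ u1) tens y (z * u2) =
    tens u 1 :> UtopU t.
  apply: galois_inj; rewrite (morph_tlift _ _ galoisD) galois_tens.
  apply: eq_tlift => u1 u2; rewrite (morph_tlift _ _ galoisD).
  have bP : balanced lt ls (fun x y => tens x (y * u2) : UtU s t).
  by apply: balanced_mulr2; apply: tens_balanced.
  rewrite mulr1 -[u2 in RHS]mul1r -(translation_galois u1 bP).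
  apply: eq_tlift => y z; rewrite galois_tens; apply: eq_tlift => y1 y2.
  by rewrite mulrA.
rewrite -(tlift_tens cP) -E tlift_tlift //; apply: eq_tlift => u1 u2.
rewrite tlift_tlift //; apply: eq_tlift => y z; by rewrite tlift_tens.
Qed.

(** u_+ u_- = s(ε(u)). *)
Lemma translation_mul u : \sw_(y, z <- τ u) y * z = s (ε u).
Proof.
rewrite -[RHS]mulr1 -(translation_galois u balanced_counitl).
apply: eq_tlift => y z; rewrite -[y in LHS](counitl H).
have fD : {morph (fun x : U => x * z) : x y / x + y}.
  by move=> ? ?; rewrite mulrDl.
by rewrite (morph_tlift _ _ fD); apply: eq_tlift => y1 y2; rewrite mulrA.
Qed.

(** The Galois map is left A-linear. *)
Lemma galois_lact a x : galois H (UtopU_lact s a x) = UtN_lact s a (galois H x).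
Proof.
have LD : {morph @UtN_lact A U s t U ls a : v w / v + w}.
  exact: tliftD (UtN_lact_balanced ls a).
rewrite /UtopU_lact (morph_tlift _ _ galoisD) /galois (morph_tlift _ _ LD).
apply: eq_tlift => u v; rewrite (morph_tlift _ _ LD) -/(galois H _) galois_tens.
rewrite copr_srcl; first by apply: eq_tlift => u1 u2; rewrite UtN_lact_tens.
by apply: balanced_mulr2; apply: tens_balanced.
Qed.

(** u_{+(1)} ⊗ u_{+(2)} ⊗ u_- = u_(1) ⊗ u_{(2)+} ⊗ u_{(2)-}: by coassociativity
    both have the same image u_(1) ⊗ u_(2) ⊗ 1 under the bijection induced by
    the Galois map on the last two factors. *)
Lemma translation_coprE u :
  translation_copr H u =
  \sw_(u1, u2 <- Δ u) (tens u1 (τ u2) : UtUtopU H).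
Proof.
case: (hopfH) => g galK gK; rewrite /translation_copr.
have gD : {morph g : x y / x + y}.
  by move=> x y; apply: galois_inj; rewrite galoisD !gK.
have gE x : g (tens x 1) = τ x.
  by apply: galois_inj; rewrite gK galois_translation.
have gL a w : g (UtN_lact s a w) = UtopU_lact s a (g w).
  by apply: galois_inj; rewrite gK galois_lact gK.
(* As g inverts the Galois map, u_{+(2)} ⊗ u_- = g(u_{+(2)} ⊗ u_{+(3)} u_-),
   so that the identity u_{+(1)} ⊗ u_{+(2)} u_- = u ⊗ 1 can be applied. *)
pose T (z : U) x v w : UtUtopU H := tens x (g (tens v (w * z))).
have TP z : trilinear ls (T z).
  split=> [w|x]; rewrite /T.
    split=> [v x x'|x v v'|x a v]; first exact: tensDl.
      by rewrite tensDl gD tensDr.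
    by rewrite tensA -gL UtN_lact_tens.
  split=> [w v v'|v w w'|v a w]; first by rewrite tensDl gD tensDr.
    by rewrite mulrDl tensDr gD tensDr.
  by rewrite tensA mulrA.
pose b x v : UtUtopU H := \sw_(x1, x2 <- Δ x) tens x1 (g (tens x2 v)).
have bT z x v : \sw_(x1, x2 <- Δ x) T z x1 x2 v = b x (v * z) by [].
have bP : balanced lt ls b.
  have Tb v : balanced lt ls (fun x1 x2 => tens x1 (g (tens x2 v)) : UtUtopU H).
    by case: (TP 1) => /(_ v); rewrite /T mulr1.
  split=> [v x x'|x v v'|x a v].
  - by rewrite /b coprD tliftD.
  - rewrite /b -tlift_split; apply: eq_tlift => x1 x2.
    by rewrite tensDr gD tensDr.
  - rewrite /b copr_tgtl //; apply: eq_tlift => x1 x2; by rewrite tensA.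
transitivity (b u 1); last by apply: eq_tlift => u1 u2; rewrite gE.
rewrite -(translation_galois u bP); apply: eq_tlift => y z.
transitivity (\sw_(y1, y2 <- Δ y) \sw_(x1, x2 <- Δ y1) T z x1 x2 y2); last first.
  by apply: eq_tlift => y1 y2.
rewrite (coact_assoc_sw _ copr_comod (TP z)); apply: eq_tlift => y1 y2.
rewrite -[tens y2 z]galK galois_tens (morph_tlift _ _ gD).
exact: tens_tliftr.
Qed.

End Hopf.
End Bialgebroid.

(** * The right action on a comodule *)

Section Comodule.
Variables (k : comPzRingType) (A U : algType k) (H : bialgebroid A U).

Local Notation s := (src H).
Local Notation t := (tgt H).
Local Notation Δ := (copr H).
Local Notation ε := (counit H).
Local Notation lt := (fun (u : U) (a : A) => t a * u).
Local Notation ls := (fun (a : A) (u : U) => s a * u).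

Variables (N : zmodType) (la : A -> N -> N) (lam : N -> UtN t la).
Hypothesis lamP : is_comodule H lam.
Let laP := comod_lmod lamP.

Lemma comod_ract_balanced a : balanced lt la (fun u n => la (ε (u * s a)) n).
Proof.
split=> [n u v|u n n'|u c n]; rewrite ?linE ?(lmodDl laP) ?(lmodDr laP) //.
by rewrite -mulrA counit_ract (lmodM laP).
Qed.

Lemma comod_ractDl a : {morph (fun n => comod_ract lam n a) : n n' / n + n'}.
Proof.
move=> n n'; rewrite /comod_ract (coactD lamP) tliftD //.
exact: comod_ract_balanced.
Qed.

Lemma comod_ractDr n : {morph comod_ract lam n : a b / a + b}.
Proof.
move=> a b; rewrite /comod_ract -tlift_split; apply: eq_tlift => u m.
by rewrite !linE (lmodDl laP).
Qed.

Lemma comod_ract_lact a b n :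
  comod_ract lam (la b n) a = la b (comod_ract lam n a).
Proof.
rewrite /comod_ract (coact_lact lamP) UtN_lact_tlift; last first.
  exact: comod_ract_balanced.
rewrite (@morph_tlift _ _ _ _ _ _ _ (la b)); last exact: lmodDr laP b.
by apply: eq_tlift => u m; rewrite -mulrA counit_lact (lmodM laP).
Qed.

Section Coaction.
Variables (V : zmodType) (b : U -> N -> V).
Hypothesis bP : balanced lt la b.

Lemma coact_lact_sw a n :
  \sw_(u, n0 <- lam (la a n)) b u n0 = \sw_(u, n0 <- lam n) b (s a * u) n0.
Proof. by rewrite (coact_lact lamP) UtN_lact_tlift. Qed.

Lemma coact_morph :
  {morph (fun n => \sw_(u, n0 <- lam n) b u n0) : n n' / n + n'}.
Proof. by move=> n n'; rewrite (coactD lamP) tliftD. Qed.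

(** (na)_(-1) ⊗ (na)_(0) = n_(-1) s(a) ⊗ n_(0). *)
Lemma coact_ract n a :
  \sw_(u, n0 <- lam (comod_ract lam n a)) b u n0 =
  \sw_(u, n0 <- lam n) b (u * s a) n0.
Proof.
case: (bP) => bl br ba.
pose T u v n0 := b (s (ε (u * s a)) * v) n0.
have TP : trilinear H la T.
  split=> [m|u]; last exact: balanced_srcl.
  split=> [v u u'|u v v'|u c v]; rewrite /T ?linE ?bl //.
  by rewrite -mulrA counit_ract srcM mulrA.
rewrite (morph_tlift _ _ coact_morph).
transitivity (\sw_(u, n1 <- lam n) \sw_(v, n0 <- lam n1) T u v n0).
  by apply: eq_tlift => u m; rewrite coact_lact_sw.
rewrite -(coact_assoc_sw _ lamP TP); apply: eq_tlift => u m.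
by rewrite -(counit_copr_src H u) (@morph_tlift _ _ _ _ _ _ _ (b^~ m)).
Qed.

(** n_(-1) t(a) ⊗ n_(0) = n_(-1) ⊗ n_(0) a. *)
Lemma coact_takeuchi n a :
  \sw_(u, n0 <- lam n) b (u * t a) n0 =
  \sw_(u, n0 <- lam n) b u (comod_ract lam n0 a).
Proof.
case: (bP) => bl br ba.
pose T u v n0 := b (t (ε (v * s a)) * u) n0.
have TP : trilinear H la T.
  split=> [m|u]; split=> [v w w'|v w w'|v c w]; rewrite /T ?linE ?bl ?br //.
  - by rewrite -mulrA counit_lact tgtM mulrA.
  - by rewrite -mulrA counit_ract tgtM -mulrA ba.
transitivity (\sw_(u, n1 <- lam n) \sw_(v, n0 <- lam n1) T u v n0); last first.
  apply: eq_tlift => u m; rewrite (morph_tlift _ _ (br u)).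
  by apply: eq_tlift => v n0; rewrite /T ba.
rewrite -(coact_assoc_sw _ lamP TP); apply: eq_tlift => u m.
by rewrite -(counit_copr_tgt H u) (@morph_tlift _ _ _ _ _ _ _ (b^~ m)).
Qed.

End Coaction.

Lemma comod_ract1 n : comod_ract lam n 1 = n.
Proof.
rewrite -[RHS](coact_counit lamP); apply: eq_tlift => u m.
by rewrite rmorph1 mulr1.
Qed.

Lemma comod_ractM n a b :
  comod_ract lam n (a * b) = comod_ract lam (comod_ract lam n a) b.
Proof.
rewrite [RHS](coact_ract (comod_ract_balanced b)); apply: eq_tlift => u m.
by rewrite srcM mulrA.
Qed.

End Comodule.

(** * Dual bases and a substitute for the antipode *)

Section DualBasis.
Variables (k : comPzRingType) (A U : algType k) (H : bialgebroid A U).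

Local Notation s := (src H).
Local Notation t := (tgt H).
Local Notation Δ := (copr H).
Local Notation ε := (counit H).
Local Notation lt := (fun (u : U) (a : A) => t a * u).
Local Notation ls := (fun (a : A) (u : U) => s a * u).
Local Notation τ := (translation H).
Local Notation balop b := (balanced (fun u a => u * t a) (fun a v => t a * v) b).

Local Notation linear_form := (homA H (fun a b : A => a * b)).

Lemma dual_basis : finitely_generated (U_right H) -> projective (U_right H) ->
  exists n (e : 'I_n -> U) (φ : 'I_n -> U -> A),
    (forall i, linear_form (φ i)) /\
    forall u, \sum_(i < n) t (φ i u) * e i = u.
Proof.
case=> n [e eP] prU; exists n, e.
pose P : lmodType A^c := 'rV[A^c]_n.
pose g (c : P) : U_right H := \sum_(i < n) c ord0 i *: e i.
have gl : linear g.
  move=> a c d; rewrite /g scaler_sumr -big_split; apply: eq_bigr => i _ /=.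
  by rewrite !mxE scalerDl scalerA.
pose G : {linear P -> U_right H} :=
  HB.pack g (GRing.isLinear.Build _ _ _ _ g gl).
have [q|l lP] := prU P (U_right H) G idfun.
  have [c ->] := eP q; exists (\row_i c i) => /=; rewrite /g.
  by apply: eq_bigr => i _; rewrite mxE.
exists (fun i u => l u ord0 i); split=> [i|u]; last by rewrite -[RHS]lP.
by split=> [u v|a u]; [rewrite raddfD mxE | rewrite (linearZ_LR l a u) mxE].
Qed.

Hypothesis hopfH : left_hopf H.

Section Form.
Variable φ : U -> A.
Hypothesis φP : linear_form φ.
Let φD := φP.1.
Let φt := φP.2.

(** K(x, v) = ε(x_+ s(φ(x_- v))), which is φ(S(x) v) if U is a Hopf algebra with
    antipode S. *)
Definition antipode_form x v : A := \sw_(y, z <- τ x) ε (y * s (φ (z * v))).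
Local Notation K := antipode_form.

Lemma antipode_form_balanced v : balop (fun y z => ε (y * s (φ (z * v)))).
Proof.
split=> [n x y|n x y|x a y]; rewrite ?linE ?φD ?linE //.
rewrite -[t a * y * v]mulrA φt srcM mulrA [RHS]counit_srcr.
by rewrite -mulrA -src_tgt_comm mulrA.
Qed.

Lemma antipode_formDl v : {morph K^~ v : x y / x + y}.
Proof.
move=> x y; rewrite /K translationD // tliftD //.
exact: antipode_form_balanced.
Qed.

Lemma antipode_formDr x : {morph K x : v w / v + w}.
Proof.
move=> v w; rewrite /K -tlift_split; apply: eq_tlift => y z.
by rewrite mulrDr φD !linE.
Qed.

Lemma antipode_form_tgtr a x v : K x (t a * v) = K x v * a.
Proof.
have cP := antipode_form_balanced v.
transitivity (\sw_(y, z <- τ x) ε (y * s (φ (z * t a * v)))).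
  by apply: eq_tlift => y z; rewrite mulrA.
rewrite -(takeuchi_op_sw a (translation_takeuchi hopfH x) cP).
have rD : {morph (fun b : A => b * a) : b c / b + c}.
  by move=> b c; rewrite mulrDl.
rewrite /K (morph_tlift _ _ rD); apply: eq_tlift => y z.
by rewrite -mulrA counit_ract.
Qed.

Lemma antipode_form_tgtl a x v : K (t a * x) v = K x (s a * v).
Proof.
rewrite /K translation_tgt // tlift_tlift; last exact: antipode_form_balanced.
apply: eq_tlift => y z; rewrite (tlift_tens (antipode_form_balanced v)).
by rewrite mulrA.
Qed.

Lemma antipode_form_srcl a x v : K (s a * x) v = a * K x v.
Proof.
rewrite /K translation_src // tlift_tlift; last exact: antipode_form_balanced.
have lD : {morph (fun b : A => a * b) : b c / b + c}.
  by move=> b c; rewrite mulrDr.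
rewrite (morph_tlift _ _ lD); apply: eq_tlift => y z.
by rewrite (tlift_tens (antipode_form_balanced v)) -mulrA counit_lact.
Qed.

Lemma antipode_form_copr x v :
  \sw_(x1, x2 <- Δ x) K x1 (x2 * v) = ε (x * s (φ v)).
Proof.
rewrite -[v in RHS]mul1r -(copr_translation hopfH x (antipode_form_balanced v)).
by apply: eq_tlift => x1 x2; apply: eq_tlift => y z; rewrite mulrA.
Qed.

End Form.

Section Basis.
Variables (n : nat) (e : 'I_n -> U) (φ : 'I_n -> U -> A).
Hypothesis φP : forall i, linear_form (φ i).
Hypothesis eP : forall u, \sum_(i < n) t (φ i u) * e i = u.

Lemma antipode_form_basis x v :
  \sum_(i < n) \sw_(x1, x2 <- Δ x) t (antipode_form (φ i) x2 v) * (x1 * e i) =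
  s (ε x) * v.
Proof.
pose c i (x : U) (w : UtopU t) :=
  \sw_(y, z <- w) t (ε (y * s (φ i (z * v)))) * (x * e i).
have cb i x1 : balop (fun y z => t (ε (y * s (φ i (z * v)))) * (x1 * e i)).
  have [bl br ba] := antipode_form_balanced (φP i) v.
  by split=> [z y y'|y z z'|y a z]; rewrite ?bl ?br ?ba ?linE.
have cP i : balanced lt (@UtopU_lact _ _ s t) (c i).
  split=> [w x1 x2|x1|x1 a w]; rewrite /c.
  - by rewrite -tlift_split; apply: eq_tlift => y z; rewrite mulrDl mulrDr.
  - exact: tliftD.
  - rewrite /UtopU_lact tlift_tlift //; apply: eq_tlift => y z.
    by rewrite (tlift_tens (cb i x1)) -[s a * y * _]mulrA counit_lact tgtM !mulrA.
transitivity (\sum_(i < n) \sw_(y, z <- τ x) y * (t (φ i (z * v)) * e i)).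
  apply: eq_bigr => i _.
  transitivity (tlift (c i) (translation_copr H x)).
    rewrite translation_coprE // (tlift_tlift _ _ (cP i)).
    apply: eq_tlift => x1 x2.
    rewrite (tlift_tens (cP i)) /c /antipode_form.
    have tD : {morph (fun a : A => t a * (x1 * e i)) : a b / a + b}.
      by move=> a b; rewrite !linE.
    by rewrite (morph_tlift _ _ tD).
  rewrite (tlift_tlift _ _ (cP i)); apply: eq_tlift => y z.
  rewrite (tlift_tlift _ _ (cP i)).
  rewrite mulrA -(counit_copr_tgt H).
  have rD : {morph (fun u : U => u * e i) : a b / a + b}.
    by move=> a b; rewrite !linE.
  rewrite (morph_tlift _ _ rD); apply: eq_tlift => y1 y2.
  by rewrite (tlift_tens (cP i)) /c (tlift_tens (cb i y1)) mulrA.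
rewrite -tlift_sumr -(translation_mul hopfH).
have rD : {morph (fun u : U => u * v) : a b / a + b} by move=> a b; rewrite !linE.
rewrite (morph_tlift _ _ rD); apply: eq_tlift => y z.
by rewrite -mulr_sumr eP mulrA.
Qed.

End Basis.
End DualBasis.

(** * Homomorphisms from U to right A-modules and contraactions *)

Section Hom.
Variables (k : comPzRingType) (A U : algType k) (H : bialgebroid A U).
Variables (M : zmodType) (ra : M -> A -> M).
Hypothesis raP : is_rmodule ra.

Local Notation s := (src H).
Local Notation t := (tgt H).

Lemma ractDl a : {morph ra^~ a : m m' / m + m'}.
Proof. exact: (lmodDr raP a). Qed.

Lemma ractDr m : {morph ra m : a b / a + b}.
Proof. by move=> a b; apply: (lmodDl raP a b m). Qed.

Lemma ractM m a b : ra m (a * b) = ra (ra m a) b.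
Proof. exact: (lmodM raP b a m). Qed.

Lemma homA0 : homA H ra (fun=> 0).
Proof. by split=> [u v|a u]; rewrite ?addr0 // (morphD0 (ractDl a)). Qed.

Lemma homAD f g : homA H ra f -> homA H ra g -> homA H ra (fun u => f u + g u).
Proof.
move=> [fD ft] [gD gt]; split=> [u v|a u].
  by rewrite fD gD addrACA.
by rewrite ft gt ractDl.
Qed.

Lemma homAN f : homA H ra f -> homA H ra (fun u => - f u).
Proof.
move=> [fD ft]; split=> [u v|a u]; first by rewrite fD opprD.
by rewrite ft (morphDN (ractDl a)).
Qed.

Lemma homA_sum I (r : seq I) (F : I -> U -> M) :
  (forall i, homA H ra (F i)) -> homA H ra (fun u => \sum_(i <- r) F i u).
Proof.
move=> FP; elim: r => [|i r IH].
  by under [X in homA _ _ X]eq_fun do rewrite big_nil; apply: homA0.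
by under [X in homA _ _ X]eq_fun do rewrite big_cons; apply: homAD.
Qed.

Lemma homA_src f a : homA H ra f -> homA H ra (fun u => f (s a * u)).
Proof.
move=> [fD ft]; split=> [u v|b u]; first by rewrite mulrDr fD.
by rewrite mulrA src_tgt_comm -mulrA ft.
Qed.

Lemma homA_form (φ : U -> A) m : homA H (fun a b : A => a * b) φ ->
  homA H ra (fun u => ra m (φ u)).
Proof.
by move=> [φD φt]; split=> [u v|a u]; rewrite ?φD ?ractDr // φt ractM.
Qed.

End Hom.

Section Contra.
Variables (k : comPzRingType) (A U : algType k) (H : bialgebroid A U).
Variables (M : zmodType) (ra : M -> A -> M) (gam : (U -> M) -> M).
Hypothesis gamP : is_contramodule H ra gam.
Let raP := contra_rmod gamP.

Local Notation s := (src H).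
Local Notation t := (tgt H).
Local Notation hom := (homA H ra).

Lemma contra0 : gam (fun=> 0) = 0.
Proof.
have h0 := homA0 H raP; apply: (@addrI _ (gam (fun=> 0))).
by rewrite -(contraD gamP) // !addr0.
Qed.

Lemma contraN f : hom f -> gam (fun u => - f u) = - gam f.
Proof.
move=> fP; apply/eqP; rewrite -addr_eq0 -(contraD gamP) //; last exact: homAN.
by apply/eqP; rewrite -contra0; congr gam; apply/funext => u; rewrite addNr.
Qed.

Lemma contra_sum I (r : seq I) (F : I -> U -> M) : (forall i, hom (F i)) ->
  gam (fun u => \sum_(i <- r) F i u) = \sum_(i <- r) gam (F i).
Proof.
move=> FP; elim: r => [|i r IH].
  rewrite [RHS]big_nil -[RHS]contra0; congr gam; apply/funext => u.
  exact: big_nil.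
rewrite big_cons -IH -(contraD gamP) //; last exact: homA_sum.
by congr gam; apply/funext => u; exact: big_cons.
Qed.

Section Tlift.
Variables (B : Type) (P Q : zmodType) (rb : P -> B -> P) (lb : B -> Q -> Q).
Variables (F : P -> Q -> U -> M) (x : tensor rb lb).
Hypothesis FP : forall p q, hom (F p q).

Lemma homA_tlift : hom (fun u => \sw_(p, q <- x) F p q u).
Proof.
have [l E] := tlift_signed_sum x; under [X in hom X]eq_fun do rewrite E.
by apply: homA_sum => // -[[] p] /=; [apply: homAN | ].
Qed.

Lemma contra_tlift :
  gam (fun u => \sw_(p, q <- x) F p q u) = \sw_(p, q <- x) gam (F p q).
Proof.
have [l E] := tlift_signed_sum x; under [X in gam X]eq_fun do rewrite E.
rewrite contra_sum => [|[[] p] /=]; [|exact: homAN|by []].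
by rewrite E; apply: eq_bigr => -[[] p] _ //=; rewrite contraN.
Qed.
End Tlift.

End Contra.

(** * Maps from U to M ⊗_A N *)

Section MtN.
Variables (k : comPzRingType) (A U : algType k) (H : bialgebroid A U).
Local Notation s := (src H).
Local Notation t := (tgt H).
Local Notation Δ := (copr H).
Local Notation ε := (counit H).
Local Notation lt := (fun (u : U) (a : A) => t a * u).
Local Notation ls := (fun (a : A) (u : U) => s a * u).
Local Notation linear_form := (homA H (fun a b : A => a * b)).
Variables (M N : zmodType) (ra : M -> A -> M) (la : A -> N -> N).
Variables (lam : N -> UtN t la).
Hypothesis lamP : is_comodule H lam.

Local Notation X := (tensor ra la).
Local Notation xr := (MtN_ract H (ra := ra) lam).

Lemma MtN_ract_balanced a :
  balanced ra la (fun m n => tens m (comod_ract lam n a) : X).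
Proof.
split=> [n m m'|m n n'|m b n]; first exact: tensDl.
  by rewrite comod_ractDl // tensDr.
by rewrite tensA comod_ract_lact.
Qed.

Lemma MtN_ract_tens m n a : xr (tens m n) a = tens m (comod_ract lam n a).
Proof. exact: (tlift_tens (MtN_ract_balanced a)). Qed.

Lemma MtN_ractDl a : {morph xr^~ a : x y / x + y}.
Proof. exact: tliftD (MtN_ract_balanced a). Qed.

Lemma MtN_rmodule : is_rmodule xr.
Proof.
split=> [x|a b x|a b x|a x y].
- rewrite -[RHS]tlift_id; apply: eq_tlift => m n; by rewrite comod_ract1.
- rewrite [in RHS]/MtN_ract tlift_tlift; last exact: MtN_ract_balanced.
  apply: eq_tlift => m n; rewrite (tlift_tens (MtN_ract_balanced a)).
  by rewrite -comod_ractM.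
- rewrite -tlift_split; apply: eq_tlift => m n.
  by rewrite (comod_ractDr lamP) tensDr.
- exact: MtN_ractDl.
Qed.

(** Φ(g, n) : u ↦ g(n_(-1) u) ⊗ n_(0). *)
Definition coact_hom (g : U -> M) (n : N) (u : U) : X :=
  \sw_(v, n0 <- lam n) tens (g (v * u)) n0.

Lemma coact_hom_balanced g u : homA H ra g ->
  balanced lt la (fun v n0 => tens (g (v * u)) n0 : X).
Proof.
move=> [gD gt]; split=> [n v w|v n n'|v a n].
- by rewrite mulrDl gD tensDl.
- exact: tensDr.
- by rewrite -mulrA gt tensA.
Qed.

Lemma coact_homD g u : homA H ra g -> {morph (coact_hom g)^~ u : n n' / n + n'}.
Proof.
move=> gP n n'; rewrite /coact_hom (coactD lamP) tliftD //.
exact: coact_hom_balanced.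
Qed.

Lemma coact_homP g n : homA H ra g -> homA H xr (coact_hom g n).
Proof.
move=> gP; split=> [u v|a u].
  rewrite /coact_hom -tlift_split; apply: eq_tlift => w n0.
  by rewrite mulrDr gP.1 tensDl.
rewrite /coact_hom (morph_tlift _ _ (MtN_ractDl a)).
transitivity (\sw_(v, n0 <- lam n)
    (tens (g (v * u)) (comod_ract lam n0 a) : X)).
  rewrite -(coact_takeuchi lamP (coact_hom_balanced u gP)).
  by apply: eq_tlift => v n0; rewrite mulrA.
by apply: eq_tlift => v n0; rewrite MtN_ract_tens.
Qed.

(** Φ(g, na) = Φ(g, n)(s(a) -). *)
Lemma coact_hom_ract g n a u : homA H ra g ->
  coact_hom g (comod_ract lam n a) u = coact_hom g n (s a * u).
Proof.
move=> gP; rewrite /coact_hom (coact_ract lamP (coact_hom_balanced u gP)).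
by apply: eq_tlift => v n0; rewrite mulrA.
Qed.

Section Basis.
Hypothesis hopfH : left_hopf H.
Variables (d : nat) (e : 'I_d -> U) (φ : 'I_d -> U -> A).
Hypothesis φP : forall i, linear_form (φ i).
Hypothesis eP : forall u, \sum_(i < d) t (φ i u) * e i = u.
Local Notation K i := (antipode_form H (φ i)).

(** A family of maps in Hom_{A^op}(U, M), parametrized additively by U and such
    that q(t(a)x, u) = q(x, s(a)u).  These are the conditions under which
    q(n_(-2), n_(-1) u) ⊗ n_(0) is well defined. *)
Record hom_family (q : U -> U -> M) : Prop := {
  hom_family_hom : forall x, homA H ra (q x);
  hom_familyD : forall u, {morph q^~ u : x y / x + y};
  hom_family_tgt : forall a x u, q (t a * x) u = q x (s a * u)
}.

Lemma hom_familyE q x u : hom_family q ->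
  q x u = \sum_(i < d) q (e i) (s (φ i x) * u).
Proof.
move=> qP; rewrite -[x in LHS]eP (morphD_sum (hom_familyD qP u)).
by apply: eq_bigr => i _; rewrite (hom_family_tgt qP).
Qed.

(** φ_i(n_(-1)) n_(0), the action on n of φ_i as an element of the dual of U. *)
Definition coact_form i (n : N) : N := \sw_(x, n0 <- lam n) la (φ i x) n0.

(** u ↦ q(n_(-2), n_(-1) u) ⊗ n_(0) is a finite sum of maps Φ(g, n'). *)
Lemma hom_family_coact q n u : hom_family q ->
  \sw_(x, n0 <- lam n) \sw_(x1, x2 <- Δ x) (tens (q x1 (x2 * u)) n0 : X) =
  \sum_(i < d) coact_hom (q (e i)) (coact_form i n) u.
Proof.
move=> qP; have qh := hom_family_hom qP.
pose T x y n0 : X := tens (q x (y * u)) n0.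
have TP : trilinear H la T.
  split=> [m|x]; last exact: coact_hom_balanced.
  split=> [y x x'|x y y'|x a y]; rewrite /T.
  - by rewrite (hom_familyD qP) tensDl.
  - by rewrite mulrDl (qh x).1 tensDl.
  - by rewrite (hom_family_tgt qP) mulrA.
rewrite (coact_assoc_sw _ lamP TP).
transitivity (\sw_(x, n1 <- lam n)
    \sum_(i < d) coact_hom (q (e i)) (la (φ i x) n1) u).
  apply: eq_tlift => x n1.
  transitivity (\sw_(y, n0 <- lam n1)
      \sum_(i < d) (tens (q (e i) (s (φ i x) * y * u)) n0 : X)).
    apply: eq_tlift => y n0; rewrite /T (hom_familyE x _ qP).
    rewrite tens_suml.
    by apply: eq_bigr => i _; rewrite mulrA.
  rewrite tlift_sumr; apply: eq_bigr => i _; rewrite /coact_hom.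
  by rewrite (coact_lact_sw lamP (coact_hom_balanced u (qh _))).
rewrite tlift_sumr; apply: eq_bigr => i _.
by rewrite -(morph_tlift _ _ (coact_homD u (qh _))).
Qed.

Hypothesis raP : is_rmodule ra.

Lemma antipode_form_hom i x : linear_form (K i x).
Proof.
split=> [u v|a u]; first exact: antipode_formDr.
exact: antipode_form_tgtr.
Qed.

Lemma antipode_hom_family i m : hom_family (fun x u => ra m (K i x u)).
Proof.
split=> [x|u x y|a x u].
- by apply: homA_form => //; apply: antipode_form_hom.
- by rewrite antipode_formDl // ractDr.
- by rewrite antipode_form_tgtl.
Qed.

(** m ⊗ n φ_i(u) = m K_i(n_(-2), n_(-1) u) ⊗ n_(0).  The maps u ↦ m ⊗ n φ_i(u)
    generate Hom_{A^op}(U, M ⊗_A N), so this brings every map into the form of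
    [hom_family_coact]. *)
Lemma tens_ract_form i m n u :
  tens m (comod_ract lam n (φ i u)) =
  \sw_(x, n0 <- lam n)
    \sw_(x1, x2 <- Δ x) tens (ra m (K i x1 (x2 * u))) n0 :> X.
Proof.
rewrite /comod_ract tens_tliftr.
apply: eq_tlift => x n0; rewrite -tensA -(antipode_form_copr hopfH (φP i)).
have fD : {morph (fun a : A => tens (ra m a) n0 : X) : a b / a + b}.
  by move=> a b; rewrite ractDr // tensDl.
exact: (morph_tlift _ _ fD).
Qed.

(** The maps Φ(g, n) generate Hom_{A^op}(U, M ⊗_A N) additively. *)
Lemma MtN_hom_ind (P : (U -> X) -> Prop) :
  (forall g n, homA H ra g -> P (coact_hom g n)) ->
  (forall f f', homA H xr f -> homA H xr f' -> P f -> P f' ->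
     P (fun u => f u + f' u)) ->
  forall f, homA H xr f -> P f.
Proof.
move=> Pc PD f fP; have xrP := MtN_rmodule.
have P0 : P (fun=> 0).
  rewrite (_ : (fun=> 0) = coact_hom (fun=> 0) 0); first exact/Pc/homA0.
  by apply/funext => u; rewrite (morphD0 (coact_homD u (homA0 H raP))).
have PS I (r : seq I) F : (forall i, homA H xr (F i)) -> (forall i, P (F i)) ->
    P (fun u => \sum_(i <- r) F i u).
  move=> Fh FP; elim: r => [|i r IH].
    by under [X in P X]eq_fun do rewrite big_nil.
  under [X in P X]eq_fun do rewrite big_cons.
  by apply: PD => //; apply: homA_sum.
have fE u : f u = \sum_(i < d) xr (f (e i)) (φ i u).
  by rewrite -[u in LHS]eP (morphD_sum fP.1); apply: eq_bigr => i _; rewrite fP.2.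
rewrite (funext fE); apply: (PS) => i; first exact: homA_form.
have [l ->] := tensor_sum (f (e i)).
under [X in P X]eq_fun => u do rewrite (morphD_sum (MtN_ractDl _)).
apply: (PS) => -[m n] /=; first exact: homA_form.
have qP := antipode_hom_family i m.
under [X in P X]eq_fun => u.
  rewrite MtN_ract_tens tens_ract_form (hom_family_coact n u qP); over.
apply: (PS) => j; [apply: coact_homP|apply: Pc]; exact: (hom_family_hom qP).
Qed.

End Basis.
End MtN.

(** * The contraaction on M ⊗_A N *)

Section TensorContra.
Variables (k : comPzRingType) (A U : algType k) (H : bialgebroid A U).
Local Notation s := (src H).
Local Notation t := (tgt H).
Local Notation Δ := (copr H).
Local Notation ε := (counit H).
Local Notation lt := (fun (u : U) (a : A) => t a * u).
Local Notation ls := (fun (a : A) (u : U) => s a * u).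
Local Notation linear_form := (homA H (fun a b : A => a * b)).
Hypothesis hopfH : left_hopf H.
Variables (d : nat) (e : 'I_d -> U) (φ : 'I_d -> U -> A).
Hypothesis φP : forall i, linear_form (φ i).
Hypothesis eP : forall u, \sum_(i < d) t (φ i u) * e i = u.
Local Notation K i := (antipode_form H (φ i)).

Variables (M N : zmodType) (ra : M -> A -> M) (la : A -> N -> N).
Variables (gam : (U -> M) -> M) (lam : N -> UtN t la).
Hypothesis gamP : is_contramodule H ra gam.
Hypothesis lamP : is_comodule H lam.
Let raP := contra_rmod gamP.
Local Notation X := (tensor ra la).
Local Notation xr := (MtN_ract H (ra := ra) lam).
Local Notation fam := (hom_family H ra).

Lemma contra_family_balanced q : fam q ->
  balanced lt la (fun x n => tens (gam (q x)) n : X).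
Proof.
move=> qP; have qh := hom_family_hom qP; split=> [n x y|x n n'|x a n].
- rewrite -tensDl -(contraD gamP) //; congr (tens (gam _) n).
  by apply/funext => u; rewrite (hom_familyD qP).
- exact: tensDr.
- rewrite -tensA -(contra_ract gamP) //; congr (tens (gam _) n).
  by apply/funext => u; rewrite (hom_family_tgt qP).
Qed.

(** γ(v ↦ m K_i(n_(-1), v)) ⊗ n_(0), the value of the contraaction at the map
    u ↦ m ⊗ n φ_i(u) (see [tensor_contra_form]). *)
Definition contra_summand i m n : X :=
  \sw_(x, n0 <- lam n) tens (gam (fun v => ra m (K i x v))) n0.

(** The contraaction on M ⊗_A N, computed from f = Σ_i f(e_i) φ_i(-).  The formula
    makes sense, and is additive, on all functions f. *)
Definition tensor_contra (f : U -> X) : X :=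
  \sum_(i < d) \sw_(m, n <- f (e i)) contra_summand i m n.

Let KP i m : fam (fun x u => ra m (K i x u)).
Proof. exact: antipode_hom_family. Qed.

Lemma contra_summand_balanced i : balanced ra la (contra_summand i).
Proof.
have bP m := contra_family_balanced (KP i m).
split=> [n m m'|m|m a n].
- rewrite /contra_summand -tlift_split; apply: eq_tlift => x n0.
  rewrite -tensDl -(contraD gamP); try exact: (hom_family_hom (KP i _)).
  by congr (tens (gam _) n0); apply/funext => u; rewrite (ractDl raP).
- exact: (coact_morph lamP (bP m)).
- rewrite /contra_summand (coact_lact_sw lamP (bP m)); apply: eq_tlift => x n0.
  congr (tens (gam _) n0); apply/funext => u.
  by rewrite -(ractM raP) antipode_form_srcl.
Qed.

Lemma tensor_contraD f g :
  tensor_contra (fun u => f u + g u) = tensor_contra f + tensor_contra g.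
Proof.
rewrite /tensor_contra -big_split; apply: eq_bigr => i _ /=.
by rewrite tliftD //; apply: contra_summand_balanced.
Qed.

Lemma tensor_contra_sum I (r : seq I) (F : I -> U -> X) :
  tensor_contra (fun u => \sum_(i <- r) F i u) =
  \sum_(i <- r) tensor_contra (F i).
Proof.
rewrite /tensor_contra exchange_big; apply: eq_bigr => i _ /=.
by rewrite tlift_sum //; apply: contra_summand_balanced.
Qed.

(** For f = Φ(g, n) the definition gives Σ_i γ(v ↦ g(n_(-2) e_i) K_i(n_(-1), v))
    ⊗ n_(0), and the map under γ is v ↦ g(s(ε(n_(-1))) v) by
    [antipode_form_basis]. *)
Lemma tensor_contraP : is_tensor_contraaction H gam lam tensor_contra.
Proof.
move=> g n gP; have [gD gt] := gP.
have bP i m := contra_family_balanced (KP i m).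
transitivity (\sum_(i < d) \sw_(x, n1 <- lam n) \sw_(y, n0 <- lam n1)
    (tens (gam (fun v => ra (g (x * e i)) (K i y v))) n0 : X)).
  apply: eq_bigr => i _; rewrite tlift_tlift; last exact: contra_summand_balanced.
  apply: eq_tlift => x n1; exact: (tlift_tens (contra_summand_balanced i)).
pose T i x y n0 : X := tens (gam (fun v => ra (g (x * e i)) (K i y v))) n0.
have KPh i m x := hom_family_hom (KP i m) x.
have TP i : trilinear H la (T i).
  split=> [n0|x]; last exact: bP.
  split=> [y x x'|x y y'|x a y]; rewrite /T.
  - rewrite -tensDl -(contraD gamP) //; congr (tens (gam _) n0).
    by apply/funext => v; rewrite mulrDl gD (ractDl raP).
  - rewrite -tensDl -(contraD gamP) //; congr (tens (gam _) n0).
    by apply/funext => v; rewrite (hom_familyD (KP i _)).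
  - congr (tens (gam _) n0); apply/funext => v.
    by rewrite -mulrA gt -(ractM raP) antipode_form_srcl.
transitivity (\sw_(x, n0 <- lam n)
    \sum_(i < d) \sw_(x1, x2 <- Δ x) T i x1 x2 n0).
  rewrite tlift_sumr; apply: eq_bigr => i _.
  by rewrite (coact_assoc_sw _ lamP (TP i)).
transitivity (\sw_(x, n0 <- lam n)
    (tens (gam (fun v => g (s (ε x) * v))) n0 : X)).
  apply: eq_tlift => x n0.
  transitivity (tens (gam (fun v =>
      \sum_(i < d) \sw_(x1, x2 <- Δ x) ra (g (x1 * e i)) (K i x2 v))) n0 : X).
    rewrite (contra_sum gamP) => [|i]; last by apply: (homA_tlift gamP).
    rewrite tens_suml.
    apply: eq_bigr => i _; rewrite (contra_tlift gamP) //.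
    by rewrite tens_tliftl.
  congr (tens (gam _) n0); apply/funext => v.
  rewrite -(antipode_form_basis hopfH φP eP) (morphD_sum gD).
  apply: eq_bigr => i _; rewrite (morph_tlift _ _ gD).
  by apply: eq_tlift => x1 x2; rewrite gt.
rewrite -[n in RHS](coact_counit lamP).
rewrite tens_tliftr.
by apply: eq_tlift => x n0; rewrite (contra_ract gamP) // tensA.
Qed.

Lemma tensor_contra_coact_hom g n : homA H ra g ->
  tensor_contra (coact_hom ra lam g n) = tens (gam g) n.
Proof. exact: tensor_contraP. Qed.

(** The equation γ'(Φ(g, n)) = γ(g) ⊗ n extends to g depending on n_(-1). *)
Lemma tensor_contra_family q n : fam q ->
  tensor_contra (fun u =>
    \sw_(x, n0 <- lam n) \sw_(x1, x2 <- Δ x) tens (q x1 (x2 * u)) n0) =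
  \sw_(x, n0 <- lam n) tens (gam (q x)) n0.
Proof.
move=> qP; have qh := hom_family_hom qP.
have E u := hom_family_coact lamP eP n u qP.
rewrite (funext E) tensor_contra_sum.
transitivity (\sum_(i < d) \sw_(x, n0 <- lam n)
    (tens (gam (fun u => q (e i) (s (φ i x) * u))) n0 : X)).
  apply: eq_bigr => i _; rewrite tensor_contra_coact_hom // /coact_form.
  rewrite tens_tliftr.
  by apply: eq_tlift => x n0; rewrite (contra_ract gamP) // tensA.
rewrite -tlift_sumr; apply: eq_tlift => x n0.
rewrite -tens_suml.
rewrite -(contra_sum gamP) => [|i]; last exact: homA_src.
by congr (tens (gam _) n0); apply/funext => u; rewrite (hom_familyE eP x u qP).
Qed.

Lemma tensor_contra_form i m n :
  tensor_contra (fun u => tens m (comod_ract lam n (φ i u))) =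
  contra_summand i m n.
Proof.
rewrite -[RHS](tensor_contra_family n (KP i m)); congr tensor_contra.
by apply/funext => u; rewrite tens_ract_form.
Qed.

Let indP := MtN_hom_ind lamP hopfH φP eP raP.

Lemma tensor_contra_ract f a : homA H xr f ->
  tensor_contra (fun u => f (s a * u)) = xr (tensor_contra f) a.
Proof.
move: f; apply: indP => [g n gP|f f' _ _ IH IH'].
  under [X in tensor_contra X]eq_fun do rewrite -(coact_hom_ract lamP) //.
  by rewrite !tensor_contra_coact_hom // MtN_ract_tens.
by rewrite !tensor_contraD IH IH' MtN_ractDl.
Qed.

Lemma tensor_contra_lactD a :
  {morph contra_lact H xr tensor_contra a : x y / x + y}.
Proof.
move=> x y; rewrite /contra_lact -tensor_contraD; congr tensor_contra.
by apply/funext => u; rewrite MtN_ractDl.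
Qed.

Lemma tensor_contra_lact a m n :
  contra_lact H xr tensor_contra a (tens m n) = tens (contra_lact H ra gam a m) n.
Proof.
have gP : homA H ra (fun u => ra m (ε (u * s a))).
  apply: homA_form => //; split=> [u v|b u]; first by rewrite mulrDl counitD.
  by rewrite -mulrA counit_ract.
rewrite /contra_lact -tensor_contra_coact_hom //.
congr tensor_contra; apply/funext => u; rewrite MtN_ract_tens // /comod_ract.
rewrite tens_tliftr.
by apply: eq_tlift => v n0; rewrite -tensA -[v * u * _]mulrA [in RHS]counitM_src.
Qed.

Lemma tensor_contra_counit x : tensor_contra (fun u => xr x (ε u)) = x.
Proof.
have lact1 (W : zmodType) (rw : W -> A -> W) gw w :
    contra_lact H rw gw 1 w = gw (fun u => rw w (ε u)).
  by congr gw; apply/funext => u; rewrite rmorph1 mulr1.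
rewrite -lact1; elim/tensor_ind: x => [m n|x y Ex Ey].
  by rewrite tensor_contra_lact lact1 (contra_counit gamP).
by rewrite (morphDB (tensor_contra_lactD 1)) Ex Ey.
Qed.

Lemma assoc_balanced i x g : homA H ra g ->
  balanced lt ls (fun u v => g (s (K i x u) * v)).
Proof.
move=> [gD gt]; have φPi := φP i; split=> [v u u'|u v v'|u a v].
- by rewrite antipode_formDr // !linE gD.
- by rewrite !linE gD.
- by rewrite antipode_form_tgtr // srcM mulrA.
Qed.

(** Contraassociativity on M ⊗_A N compares with contraassociativity of M through
    the family x ↦ (u ↦ g(s(K_i(x, u_(1))) u_(2))). *)
Lemma assoc_family i g : homA H ra g ->
  fam (fun x u => \sw_(u1, u2 <- Δ u) g (s (K i x u1) * u2)).
Proof.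
move=> gP; have bP x := assoc_balanced i x gP.
have [gD gt] := gP; have φPi := φP i.
split=> [x|u x y|a x u].
- split=> [u v|a u]; first by rewrite coprD tliftD.
  rewrite (copr_tgtl (bP x)) (morph_tlift _ _ (ractDl raP a)).
  by apply: eq_tlift => u1 u2; rewrite mulrA src_tgt_comm -mulrA gt.
- rewrite -tlift_split; apply: eq_tlift => u1 u2.
  by rewrite antipode_formDl // !linE gD.
- rewrite (copr_srcl (bP x)); apply: eq_tlift => u1 u2.
  by rewrite antipode_form_tgtl.
Qed.

(** Contraassociativity for the maps u ⊗ v ↦ f(s(φ_i(u)) v).  Every map G to
    which the axiom applies is a sum of such maps, with f = G(e_i ⊗ -), since
    u ⊗ v = Σ_i e_i ⊗ s(φ_i(u)) v. *)
Lemma tensor_contra_assoc_form i f : homA H xr f ->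
  tensor_contra (fun u => tensor_contra (fun v => f (s (φ i u) * v))) =
  tensor_contra (fun u => \sw_(u1, u2 <- Δ u) f (s (φ i u1) * u2)).
Proof.
move: f; apply: indP => [g n gP|f f' fP fP' IH IH']; last first.
  rewrite (_ : (fun u => \sw_(u1, u2 <- Δ u) (f _ + f' _)) = fun u =>
      \sw_(u1, u2 <- Δ u) f (s (φ i u1) * u2) +
      \sw_(u1, u2 <- Δ u) f' (s (φ i u1) * u2)); last first.
    by apply/funext => u; rewrite tlift_split.
  rewrite tensor_contraD -IH -IH' -tensor_contraD; congr tensor_contra.
  by apply/funext => u; rewrite tensor_contraD.
have [gD gt] := gP; have φPi := φP i.
(* For f = Φ(g, n) the left-hand side is γ'(u ↦ γ(g) ⊗ n φ_i(u)). *)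
transitivity (contra_summand i (gam g) n).
  rewrite -tensor_contra_form; congr tensor_contra; apply/funext => u.
  under [X in tensor_contra X]eq_fun do rewrite -(coact_hom_ract lamP) //.
  by rewrite tensor_contra_coact_hom.
have qP := assoc_family i gP.
(* Contraassociativity of M, applied to u ⊗ v ↦ g(s(K_i(x, u)) v). *)
transitivity (\sw_(x, n0 <- lam n) (tens (gam (fun u =>
    \sw_(u1, u2 <- Δ u) g (s (K i x u1) * u2))) n0 : X)).
  apply: eq_tlift => x n0; congr (tens _ n0).
  pose b u v := g (s (K i x u) * v).
  have bP : balanced lt ls b := assoc_balanced i x gP.
  pose G : {additive UtU s t -> M} :=
    HB.pack (tlift b : UtU s t -> M)
      (GRing.isZmodMorphism.Build _ _ (tlift b : UtU s t -> M) (tliftB bP)).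
  have GE u v : G (tens u v) = b u v by exact: tlift_tens.
  rewrite -[RHS](@contra_assoc _ _ _ _ _ _ _ gamP G) => [|u v a].
    congr gam; apply/funext => u; rewrite -(contra_ract gamP) //.
    by congr gam; apply/funext => v; rewrite GE.
  by rewrite !GE /b mulrA src_tgt_comm -mulrA gt.
rewrite -(tensor_contra_family n qP); congr tensor_contra; apply/funext => u.
rewrite /coact_hom [RHS]exchange_tlift; apply: eq_tlift => x n0.
transitivity (tens (\sw_(x1, x2 <- Δ x) \sw_(u1, u2 <- Δ (x2 * u))
    g (s (K i x1 u1) * u2)) n0 : X).
  by rewrite tens_tliftl.
transitivity (tens (\sw_(u1, u2 <- Δ u)
    g (x * (s (φ i u1) * u2))) n0 : X); last first.
  by rewrite tens_tliftl.
congr (tens _ n0).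
have bP y := assoc_balanced i y gP.
(* It remains to see that g(s(K_i(x_(1), x_(2) u_(1))) x_(3) u_(2)) equals
   g(x s(φ_i(u_(1))) u_(2)). *)
under eq_tlift => x1 x2 do rewrite (coprM_sw (bP x1)).
rewrite exchange_tlift; apply: eq_tlift => u1 u2.
pose T y1 y2 y3 := g (s (K i y1 (y2 * u1)) * (y3 * u2)).
have TP : trilinear H ls T.
  split=> [y3|y1]; split=> [w y y'|w y y'|w a y]; rewrite /T.
  - by rewrite antipode_formDl // !linE gD.
  - by rewrite mulrDl antipode_formDr // !linE gD.
  - by rewrite antipode_form_tgtl // !mulrA.
  - by rewrite mulrDl antipode_formDr // !linE gD.
  - by rewrite !linE gD.
  - by rewrite -mulrA antipode_form_tgtr // srcM !mulrA.
rewrite -(coact_assoc_sw _ (copr_comod H) TP).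
rewrite mulrA -(counit_copr_src H).
have fD : {morph (fun v : U => g (v * u2)) : v w / v + w}.
  by move=> v w; rewrite mulrDl gD.
rewrite (morph_tlift _ _ fD); apply: eq_tlift => x1 x2.
have fD' : {morph (fun a : A => g (s a * (x2 * u2))) : v w / v + w}.
  by move=> v w; rewrite !linE gD.
rewrite -mulrA -(antipode_form_copr hopfH φPi) (morph_tlift _ _ fD').
by [].
Qed.

Lemma tensor_contra_contramodule : is_contramodule H xr tensor_contra.
Proof.
split; [exact: MtN_rmodule | by move=> *; apply: tensor_contraD
       | by move=> *; apply: tensor_contra_ract | | exact: tensor_contra_counit].
move=> g gt.
have gP i : homA H xr (fun v => g (tens (e i) v)).
  by split=> [u v|a u]; [rewrite tensDr raddfD | rewrite gt].
have gE u v : g (tens u v) = \sum_(i < d) g (tens (e i) (s (φ i u) * v)).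
  rewrite -[u in LHS]eP (@morphD_sum _ _ (fun u => g (tens u v))) => [|x y].
    by apply: eq_bigr => i _; rewrite tensA.
  by rewrite tensDl raddfD.
transitivity (\sum_(i < d) tensor_contra (fun u => tensor_contra (fun v =>
    g (tens (e i) (s (φ i u) * v))))).
  rewrite -tensor_contra_sum; congr tensor_contra; apply/funext => u.
  by rewrite -tensor_contra_sum; congr tensor_contra; apply/funext => v.
rewrite (eq_bigr _ (fun i _ => tensor_contra_assoc_form i (gP i))).
rewrite -tensor_contra_sum; congr tensor_contra; apply/funext => u.
rewrite -tlift_sumr -[Δ u in RHS]tlift_id (morph_tlift _ _ (raddfD g)).
by apply: eq_tlift => u1 u2; rewrite gE.
Qed.

End TensorContra.

(** * The anti Yetter-Drinfel'd condition *)

Section Twist.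
Variables (k : comPzRingType) (A U : algType k) (H : bialgebroid A U).
Local Notation s := (src H).
Local Notation t := (tgt H).
Local Notation Δ := (copr H).
Local Notation ε := (counit H).
Local Notation lt := (fun (u : U) (a : A) => t a * u).
Local Notation ls := (fun (a : A) (u : U) => s a * u).
Local Notation τ := (translation H).
Local Notation balop b := (balanced (fun u a => u * t a) (fun a v => t a * v) b).
Local Notation linear_form := (homA H (fun a b : A => a * b)).
Hypothesis hopfH : left_hopf H.

Variables (M : zmodType) (act : U -> M -> M) (ra : M -> A -> M).
Hypothesis actP : is_lmodule act.
Hypothesis act_tgt : forall a m, act (t a) m = ra m a.

Section Translate.
Variable f : U -> M.
Hypothesis fP : homA H ra f.
Let fD := fP.1.
Let ft := fP.2.

Lemma act_hom_balanced x : balop (fun y z => act y (f (z * x))).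
Proof.
split=> [z y y'|y z z'|y a z]; first by rewrite (lmodDl actP).
  by rewrite mulrDl fD (lmodDr actP).
by rewrite -mulrA ft (lmodM actP) act_tgt.
Qed.

(** x ↦ y f(zx), summed over the terms y ⊗ z of a tensor with [takeuchi_op], lies
    in Hom_{A^op}(U, M). *)
Lemma act_hom_takeuchi v : takeuchi_op (H := H) v ->
  homA H ra (fun x => \sw_(y, z <- v) act y (f (z * x))).
Proof.
move=> vP; split=> [x x'|a x].
  rewrite -tlift_split; apply: eq_tlift => y z.
  by rewrite mulrDr fD (lmodDr actP).
rewrite -act_tgt (morph_tlift _ _ (lmodDr actP (t a))).
transitivity (\sw_(y, z <- v) act (t a * y) (f (z * x))).
  rewrite (takeuchi_op_sw a vP (act_hom_balanced x)).
  by apply: eq_tlift => y z; rewrite mulrA.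
by apply: eq_tlift => y z; rewrite (lmodM actP).
Qed.

Lemma act_hom_family :
  hom_family H ra (fun p x => \sw_(y, z <- τ p) act y (f (z * x))).
Proof.
split=> [p|x p p'|a p x].
- exact/act_hom_takeuchi/translation_takeuchi.
- by rewrite translationD // tliftD //; apply: act_hom_balanced.
- rewrite translation_tgt // tlift_tlift; last exact: act_hom_balanced.
  apply: eq_tlift => y z.
  by rewrite (tlift_tens (act_hom_balanced x)) mulrA.
Qed.

End Translate.

Variable (gam : (U -> M) -> M).
Hypothesis gamP : is_contramodule H ra gam.
Hypothesis act_src : forall a m, act (s a) m = contra_lact H ra gam a m.
Let raP := contra_rmod gamP.

(** γ(F(- t(a))) = γ(a F(-)): contraassociativity for w ⊗ v ↦ F(w) ε(v s(a)). *)
Lemma contra_tgt F a : homA H ra F ->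
  gam (fun w => F (w * t a)) = gam (fun w => act (s a) (F w)).
Proof.
move=> [FD Ft].
pose b w v := ra (F w) (ε (v * s a)).
have bP : balanced lt ls b.
  split=> [v w w'|w v v'|w c v]; rewrite /b ?FD ?(ractDl raP) //.
    by rewrite mulrDl counitD (ractDr raP).
  by rewrite Ft -mulrA counit_lact (ractM raP).
pose G : {additive UtU s t -> M} :=
  HB.pack (tlift b : UtU s t -> M)
    (GRing.isZmodMorphism.Build _ _ (tlift b : UtU s t -> M) (tliftB bP)).
have GE u v : G (tens u v) = b u v by exact: tlift_tens.
have GA u v c : G (tens u (t c * v)) = ra (G (tens u v)) c.
  by rewrite !GE /b -mulrA counit_ract (ractM raP).
transitivity (gam (fun w => G (Δ w))).
  congr gam; apply/funext => w; rewrite -(counit_copr_tgt H) (morph_tlift _ _ FD).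
  by apply: eq_tlift => w1 w2; rewrite Ft.
rewrite -(contra_assoc gamP GA); congr gam; apply/funext => w.
by rewrite act_src; congr gam; apply/funext => v; rewrite GE.
Qed.

Lemma takeuchi_op_lact a v : takeuchi_op (H := H) v ->
  takeuchi_op (H := H) (UtopU_lact s a v).
Proof.
move=> vP b.
have [bl br ba] :=
  tens_balanced (fun (u : U) (a : A) => u * t a) (fun a v => t a * v).
have P1 : balop (fun y z => tens (t b * y) z : UtopU t).
  by split=> [z y y'|y z z'|y c z]; rewrite ?mulrDr ?bl ?br // mulrA ba.
have P2 : balop (fun y z => tens y (z * t b) : UtopU t).
  by split=> [z y y'|y z z'|y c z]; rewrite ?mulrDl ?bl ?br // ba mulrA.
have P3 : balop (fun y z => tens (s a * y) z : UtopU t).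
  by split=> [z y y'|y z z'|y c z]; rewrite ?mulrDr ?bl ?br // mulrA ba.
rewrite /UtopU_lact !tlift_tlift //.
transitivity (\sw_(y, z <- v) (tens (s a * (t b * y)) z : UtopU t)).
  apply: eq_tlift => y z; rewrite (tlift_tens P1).
  by rewrite !mulrA src_tgt_comm.
rewrite (takeuchi_op_sw b vP P3).
by apply: eq_tlift => y z; rewrite (tlift_tens P2).
Qed.

Lemma contra_sum_in (I : eqType) (r : seq I) (F : I -> U -> M) :
  {in r, forall i, homA H ra (F i)} ->
  gam (fun u => \sum_(i <- r) F i u) = \sum_(i <- r) gam (F i).
Proof.
move=> FP; rewrite big_tnth -(contra_sum gamP); last first.
  by move=> i; apply: FP; apply: mem_tnth.
by congr gam; apply/funext => u; rewrite big_tnth.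
Qed.

(** γ(w ↦ y f(z w x)), summed over the terms y ⊗ z of v.  It is meaningful when v
    satisfies [takeuchi_op], for then the argument of γ is in
    Hom_{A^op}(U, M). *)
Definition twisted_contra (f : U -> M) (x : U) (v : UtopU t) : M :=
  gam (fun w => \sw_(y, z <- v) act y (f (z * w * x))).

Section TwistedContra.
Variable f : U -> M.
Hypothesis fP : homA H ra f.
Let fD := fP.1.
Let ft := fP.2.

Lemma homA_mulr x : homA H ra (fun w => f (w * x)).
Proof. by split=> [u v|a u]; rewrite ?mulrDl ?fD // -mulrA ft. Qed.

Lemma twisted_hom x v : takeuchi_op (H := H) v ->
  homA H ra (fun w => \sw_(y, z <- v) act y (f (z * w * x))).
Proof. by move=> vP; apply: (act_hom_takeuchi (homA_mulr x) vP). Qed.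

Lemma twisted_balanced x w : balop (fun y z => act y (f (z * w * x))).
Proof. exact: (act_hom_balanced (homA_mulr x) w). Qed.

Lemma twisted_contra_tgt a x v : takeuchi_op (H := H) v ->
  twisted_contra f (t a * x) v = twisted_contra f x (UtopU_lact s a v).
Proof.
move=> vP; transitivity (gam (fun w =>
    \sw_(y, z <- v) act y (f (z * (w * t a) * x)))).
  congr gam; apply/funext => w; apply: eq_tlift => y z.
  by rewrite !mulrA.
rewrite (contra_tgt a (twisted_hom x vP)); congr gam; apply/funext => w.
rewrite /UtopU_lact tlift_tlift; last exact: twisted_balanced.
rewrite (morph_tlift _ _ (lmodDr actP (s a))); apply: eq_tlift => y z.
by rewrite (tlift_tens (twisted_balanced x w)) (lmodM actP).
Qed.

Lemma twisted_contra_ract a x u :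
  twisted_contra f x (τ (t a * u)) = ra (twisted_contra f x (τ u)) a.
Proof.
have xP := twisted_hom x (translation_takeuchi hopfH u).
rewrite /twisted_contra -(contra_ract gamP) //; congr gam; apply/funext => w.
rewrite translation_tgt // tlift_tlift; last exact: twisted_balanced.
apply: eq_tlift => y z; rewrite (tlift_tens (twisted_balanced x w)).
by rewrite !mulrA.
Qed.

Lemma twisted_contra_balanced :
  balanced lt ls (fun u1 u2 => twisted_contra f u1 (τ u2)).
Proof.
have τP u := translation_takeuchi hopfH u.
split=> [v x x'|x v v'|x a v].
- rewrite -(contraD gamP); try exact: twisted_hom.
  congr gam; apply/funext => w; rewrite -tlift_split; apply: eq_tlift => y z.
  by rewrite mulrDr fD (lmodDr actP).
- rewrite -(contraD gamP); try exact: twisted_hom.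
  congr gam; apply/funext => w; rewrite translationD // tliftD //.
  exact: twisted_balanced.
- by rewrite twisted_contra_tgt // translation_src.
Qed.

Variables (d : nat) (e : 'I_d -> U) (φ : 'I_d -> U -> A).
Hypothesis φP : forall i, linear_form (φ i).
Hypothesis eP : forall u, \sum_(i < d) t (φ i u) * e i = u.

Lemma contract_balanced i :
  balanced lt (@UtopU_lact A U s t) (fun x v => UtopU_lact s (φ i x) v).
Proof.
have [bl br ba] :=
  tens_balanced (fun (u : U) (a : A) => u * t a) (fun a v => t a * v).
have sP a : balop (fun y z => tens (s a * y) z : UtopU t).
  by split=> [z y y'|y z z'|y c z]; rewrite ?mulrDr ?bl ?br // mulrA ba.
split=> [v x x'|x v v'|x a v]; rewrite /UtopU_lact.
- rewrite -tlift_split; apply: eq_tlift => y z.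
  by rewrite (φP i).1 !linE tensDl.
- exact: tliftD.
- rewrite tlift_tlift //; apply: eq_tlift => y z.
  by rewrite (tlift_tens (sP _)) (φP i).2 srcM mulrA.
Qed.

(** With Σ_p x_p ⊗ v_p the tensor underlying c, the value of γ is
    Σ_i γ(w ↦ y f(z w e_i)), summed over the terms y ⊗ z of Σ_p s(φ_i(x_p)) v_p.
    So it depends only on the tensor, not on its expression c. *)
Lemma twisted_contra_sum (c : seq (U * UtopU t)) :
  {in c, forall p, takeuchi_op (H := H) p.2} ->
  gam (fun w => \sum_(p <- c) \sw_(y, z <- p.2) act y (f (z * w * p.1))) =
  \sum_(i < d) twisted_contra f (e i)
    (\sw_(x, v <- \sum_(p <- c) (tens p.1 p.2 : UtUtopU H))
        UtopU_lact s (φ i x) v).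
Proof.
move=> cP; rewrite contra_sum_in => [|p pc]; last exact/twisted_hom/cP.
transitivity (\sum_(p <- c) \sum_(i < d)
    twisted_contra f (e i) (UtopU_lact s (φ i p.1) p.2)).
  apply: eq_big_seq => p /cP vP.
  transitivity (\sum_(i < d) twisted_contra f (t (φ i p.1) * e i) p.2);
      last first.
    by apply: eq_bigr => i _; rewrite twisted_contra_tgt.
  rewrite -(contra_sum gamP) => [|i]; last exact: twisted_hom.
  congr gam; apply/funext => w; rewrite -tlift_sumr; apply: eq_tlift => y z.
  rewrite -(morphD_sum (lmodDr actP y)) -(morphD_sum fD) -mulr_sumr.
  by rewrite eP.
rewrite exchange_big; apply: eq_bigr => i _ /=.
rewrite tlift_sum; last exact: contract_balanced.
rewrite -contra_sum_in => [|p /cP vP]; last exact/twisted_hom/takeuchi_op_lact.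
congr gam; apply/funext => w; rewrite tlift_sum; last exact: twisted_balanced.
apply: eq_bigr => p _; congr tlift.
by rewrite (tlift_tens (contract_balanced i)).
Qed.

(** The expression u_(1) ⊗ (u_{(2)+} ⊗ u_{(2)-}) is admissible in the anti
    Yetter-Drinfel'd condition. *)
Lemma translation_copr_sum u : exists c : seq (U * UtopU t),
  [/\ {in c, forall p, takeuchi_op (H := H) p.2},
      translation_copr H u = \sum_(p <- c) tens p.1 p.2
    & gam (fun w => \sum_(p <- c) \sw_(y, z <- p.2) act y (f (z * w * p.1))) =
      \sw_(u1, u2 <- Δ u) twisted_contra f u1 (τ u2)].
Proof.
have [l lE] := tensor_sum (Δ u).
pose c := [seq (p.1, τ p.2) | p <- l].
have cP : {in c, forall p, takeuchi_op (H := H) p.2}.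
  by move=> _ /mapP[p _ ->]; apply: translation_takeuchi.
have bP : balanced lt ls (fun u1 u2 => tens u1 (τ u2) : UtUtopU H).
  split=> [v x x'|x v v'|x a v]; first exact: tensDl.
    by rewrite translationD // tensDr.
  by rewrite tensA translation_src.
exists c; split=> //.
  rewrite translation_coprE // lE (tlift_sum _ _ bP) big_map.
  by apply: eq_bigr => p _; rewrite (tlift_tens bP).
rewrite contra_sum_in => [|p /cP]; last exact: twisted_hom.
rewrite lE (tlift_sum _ _ twisted_contra_balanced) big_map.
by apply: eq_bigr => p _; rewrite (tlift_tens twisted_contra_balanced).
Qed.

(** All admissible expressions of u_{+(1)} ⊗ u_{+(2)} ⊗ u_- give the same value
    γ(w ↦ u_{(2)+} f(u_{(2)-} w u_(1))). *)
Lemma twisted_contra_copr u (c : seq (U * UtopU t)) :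
  {in c, forall p, takeuchi_op (H := H) p.2} ->
  translation_copr H u = \sum_(p <- c) tens p.1 p.2 ->
  gam (fun w => \sum_(p <- c) \sw_(y, z <- p.2) act y (f (z * w * p.1))) =
  \sw_(u1, u2 <- Δ u) twisted_contra f u1 (τ u2).
Proof.
move=> cP cE; have [c' [cP' cE' <-]] := translation_copr_sum u.
by rewrite !twisted_contra_sum // -cE -cE'.
Qed.

End TwistedContra.
End Twist.

(** * The diagonal action on M ⊗_A N *)

Section TensorAct.
Variables (k : comPzRingType) (A U : algType k) (H : bialgebroid A U).
Local Notation s := (src H).
Local Notation t := (tgt H).
Local Notation Δ := (copr H).
Local Notation ε := (counit H).
Local Notation lt := (fun (u : U) (a : A) => t a * u).
Local Notation ls := (fun (a : A) (u : U) => s a * u).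
Local Notation τ := (translation H).
Local Notation balop b := (balanced (fun u a => u * t a) (fun a v => t a * v) b).
Local Notation linear_form := (homA H (fun a b : A => a * b)).

Variables (M N : zmodType) (actM : U -> M -> M) (ra : M -> A -> M).
Variables (actN : U -> N -> N) (la : A -> N -> N) (lam : N -> UtN t la).
Hypothesis actMP : is_lmodule actM.
Hypothesis actM_tgt : forall a m, actM (t a) m = ra m a.
Hypothesis YDP : is_YD H actN lam.
Let actNP := YD_lmod YDP.
Let lamP := YD_comod YDP.
Local Notation X := (tensor ra la).
Local Notation xr := (MtN_ract H (ra := ra) lam).
Local Notation actX := (MtN_act H (ra := ra) (la := la) actM actN).

Lemma diag_act_balanced m n :
  balanced lt ls (fun u1 u2 => tens (actM u1 m) (actN u2 n) : X).
Proof.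
split=> [v u u'|v u u'|u a v].
- by rewrite (lmodDl actMP) tensDl.
- by rewrite (lmodDl actNP) tensDr.
- by rewrite (lmodM actMP) actM_tgt tensA (lmodM actNP) (YD_lact YDP).
Qed.

Lemma MtN_act_balanced u :
  balanced ra la (fun m n =>
    \sw_(u1, u2 <- Δ u) tens (actM u1 m) (actN u2 n) : X).
Proof.
split=> [n m m'|m n n'|m a n].
- by rewrite -tlift_split; apply: eq_tlift => x y; rewrite (lmodDr actMP) tensDl.
- by rewrite -tlift_split; apply: eq_tlift => x y; rewrite (lmodDr actNP) tensDr.
- transitivity (\sw_(u1, u2 <- Δ u) (tens (actM (u1 * t a) m) (actN u2 n) : X)).
    by apply: eq_tlift => x y; rewrite (lmodM actMP) actM_tgt.
  rewrite (copr_takeuchi_sw (diag_act_balanced m n)); apply: eq_tlift => x y.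
  by rewrite (lmodM actNP) (YD_lact YDP).
Qed.

Lemma MtN_act_tens u m n :
  actX u (tens m n) = \sw_(u1, u2 <- Δ u) tens (actM u1 m) (actN u2 n).
Proof. exact: tlift_tens (MtN_act_balanced u) m n. Qed.

Lemma MtN_actDr u : {morph actX u : x y / x + y}.
Proof. exact: tliftD (MtN_act_balanced u). Qed.

Lemma MtN_act_lmodule : is_lmodule actX.
Proof.
split=> [x|u v x|u v x|u x y].
- rewrite -[RHS]tlift_id; apply: eq_tlift => m n.
  by rewrite (copr1_sw (diag_act_balanced m n)) (lmod1 actMP) (lmod1 actNP).
- rewrite [actX v x]/MtN_act (morph_tlift _ _ (MtN_actDr u)).
  apply: eq_tlift => m n; rewrite (morph_tlift _ _ (MtN_actDr u)).
  rewrite (coprM_sw (diag_act_balanced m n)); apply: eq_tlift => v1 v2.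
  rewrite MtN_act_tens; apply: eq_tlift => u1 u2.
  by rewrite (lmodM actMP) (lmodM actNP).
- rewrite /MtN_act -tlift_split; apply: eq_tlift => m n.
  by rewrite coprD tliftD //; apply: diag_act_balanced.
- exact: MtN_actDr.
Qed.

Lemma MtN_act_src a m n : actX (s a) (tens m n) = tens (actM (s a) m) n.
Proof.
rewrite MtN_act_tens (copr_src (diag_act_balanced m n)).
by rewrite (lmod1 actNP).
Qed.

Lemma MtN_act_tgt a x : actX (t a) x = xr x a.
Proof.
apply: eq_tlift => m n; rewrite (copr_tgt (diag_act_balanced m n)).
by rewrite (lmod1 actMP) (YD_ract YDP).
Qed.

Lemma YD_compat_sw (V : zmodType) (b : U -> N -> V) u n : balanced lt la b ->
  \sw_(u1, u2 <- Δ u) \sw_(v, n0 <- lam (actN u1 n)) b (v * u2) n0 =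
  \sw_(v, n0 <- lam n) \sw_(u1, u2 <- Δ u) b (u1 * v) (actN u2 n0).
Proof.
move=> bP; have /(congr1 (tlift b)) := YD_compat YDP u n.
rewrite !tlift_tlift // => E.
transitivity (\sw_(u1, u2 <- Δ u) tlift b
    (\sw_(v, n0 <- lam (actN u1 n)) (tens (v * u2) n0 : UtN t la))).
  apply: eq_tlift => u1 u2; rewrite tlift_tlift //; apply: eq_tlift => v n0.
  by rewrite tlift_tens.
rewrite E; apply: eq_tlift => v n0.
rewrite tlift_tlift //; apply: eq_tlift => u1 u2; by rewrite tlift_tens.
Qed.

Hypothesis hopfH : left_hopf H.

Section Twist.
Variable q : U -> M.
Hypothesis qP : homA H ra q.
Let P p x := \sw_(y, z <- τ p) actM y (q (z * x)).
Let PP : hom_family H ra P.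
Proof. exact: (act_hom_family hopfH actMP actM_tgt qP). Qed.
Let Ph := hom_family_hom PP.
Let PD := hom_familyD PP.

Lemma coact_act_balancedr p c :
  balanced lt la (fun v n0 => tens (P p (v * c)) n0 : X).
Proof.
split=> [n v w|v n n'|v a n]; first by rewrite mulrDl (Ph p).1 tensDl.
  exact: tensDr.
by rewrite -mulrA (Ph p).2 tensA.
Qed.

Lemma actN_tgt a u n : actN (t a * u) n = comod_ract lam (actN u n) a.
Proof. by rewrite (lmodM actNP) (YD_ract YDP). Qed.

Lemma actN_src a u n : actN (s a * u) n = la a (actN u n).
Proof. by rewrite (lmodM actNP) (YD_lact YDP). Qed.

(** With P(p, x) = p_+ q(p_- x), the left-hand side is
    P(y_(1), (y_(2) n)_(-1)) ⊗ (y_(2) n)_(0).  As y ⊗ 1 = y_{+(1)} ⊗ y_{+(2)} y_-,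
    it equals P(y_{+(1)}, (y_{+(2)} n)_(-1) y_{+(3)} y_-) ⊗ (y_{+(2)} n)_(0), which
    is P(y_{+(1)}, y_{+(2)} n_(-1) y_-) ⊗ y_{+(3)} n_(0) by the Yetter-Drinfel'd
    condition.  Finally P(a_(1), a_(2) x) = a q(x). *)
Lemma twisted_YD y n :
  \sw_(p, r <- Δ y) \sw_(v, n0 <- lam (actN r n)) (tens (P p v) n0 : X) =
  \sw_(a, b <- τ y) \sw_(v, n0 <- lam n) \sw_(a1, a2 <- Δ a)
    tens (actM a1 (q (v * b))) (actN a2 n0).
Proof.
pose T c p r x : X := \sw_(v, n0 <- lam (actN r n)) tens (P p (v * (x * c))) n0.
have TP c : trilinear H ls (T c).
  split=> [x|p].
    split=> [r p p'|p r r'|p a r]; rewrite /T.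
    - by rewrite -tlift_split; apply: eq_tlift => v n0; rewrite PD tensDl.
    - by rewrite (lmodDl actNP) (coact_morph lamP (coact_act_balancedr p _)).
    - rewrite actN_src (coact_lact_sw lamP (coact_act_balancedr p _)).
      apply: eq_tlift => v n0.
      by rewrite (hom_family_tgt PP) !mulrA.
  split=> [x r r'|r x x'|r a x]; rewrite /T.
  - by rewrite (lmodDl actNP) (coact_morph lamP (coact_act_balancedr p _)).
  - rewrite -tlift_split; apply: eq_tlift => v n0.
    by rewrite mulrDl mulrDr (Ph p).1 tensDl.
  - rewrite actN_tgt (coact_ract lamP (coact_act_balancedr p _)).
    by apply: eq_tlift => v n0; rewrite !mulrA.
pose b x c : X := \sw_(p, r <- Δ x) T 1 p r c.
have bP : balanced lt ls b.
  have T1 c : balanced lt ls (fun p r => T 1 p r c) by case: (TP 1) => /(_ c).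
  split=> [c x x'|x c c'|x a c]; rewrite /b.
  - by rewrite coprD tliftD.
  - rewrite -tlift_split; apply: eq_tlift => p r.
    by case: (TP 1) => _ /(_ p)[_ ->].
  - rewrite copr_tgtl //; apply: eq_tlift => p r.
    by case: (TP 1) => _ /(_ p)[_ _ ->].
transitivity (b y 1).
  by apply: eq_tlift => p r; apply: eq_tlift => v n0; rewrite !mulr1.
rewrite -(translation_galois hopfH y bP); apply: eq_tlift => x c.
transitivity (\sw_(x1, x2 <- Δ x) \sw_(p, r <- Δ x1) T c p r x2).
  apply: eq_tlift => x1 x2; apply: eq_tlift => p r; apply: eq_tlift => v n0.
  by rewrite mulr1.
rewrite (coact_assoc_sw _ (copr_comod H) (TP c)).
pose T' v n0 p r a2 : X := tens (P p (r * v * c)) (actN a2 n0).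
have TP' v n0 : trilinear H ls (T' v n0).
  split=> [a|p]; split=> [w p' r|w p' r|w a' p']; rewrite /T'.
  - by rewrite PD tensDl.
  - by rewrite !mulrDl (Ph _).1 tensDl.
  - by rewrite (hom_family_tgt PP) !mulrA.
  - by rewrite !mulrDl (Ph _).1 tensDl.
  - by rewrite (lmodDl actNP) tensDr.
  - by rewrite -!mulrA (Ph p).2 tensA actN_src.
transitivity (\sw_(v, n0 <- lam n) \sw_(p, x' <- Δ x) \sw_(r, a2 <- Δ x')
    T' v n0 p r a2).
  rewrite exchange_tlift; apply: eq_tlift => p x'.
  rewrite -(YD_compat_sw x' n (coact_act_balancedr p c)).
  by apply: eq_tlift => r a2; apply: eq_tlift => v n0; rewrite mulrA.
apply: eq_tlift => v n0; rewrite -(coact_assoc_sw _ (copr_comod H) (TP' v n0)).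
apply: eq_tlift => a1 a2.
have cP := act_hom_balanced actMP actM_tgt qP (v * c).
rewrite -[in RHS](mul1r (v * c)) -(copr_translation hopfH a1 cP).
rewrite tens_tliftl.
apply: eq_tlift => p r; congr (tens _ _); apply: eq_tlift => w z.
by rewrite !mulrA.
Qed.

End Twist.

Variable (gam : (U -> M) -> M).
Hypothesis aYDP : is_aYD_contramodule H actM ra gam.
Let gamP := aYD_contra aYDP.
Variables (d : nat) (e : 'I_d -> U) (φ : 'I_d -> U -> A).
Hypothesis φP : forall i, linear_form (φ i).
Hypothesis eP : forall u, \sum_(i < d) t (φ i u) * e i = u.

Local Notation gamX := (tensor_contra e φ (la := la) gam lam).

Lemma aYD_twisted u f : homA H ra f ->
  actM u (gam f) = \sw_(u1, u2 <- Δ u) twisted_contra actM gam f u1 (τ u2).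
Proof.
move=> fP.
have [c [cP cE <-]] :=
  translation_copr_sum hopfH actMP actM_tgt gamP (aYD_lact aYDP) fP u.
exact: (aYD_compat aYDP fP cP cE).
Qed.

(** [twisted_YD] for q = g(- w x), placed under γ for M and under the contraaction
    for M ⊗_A N. *)
Lemma tensor_contra_twisted x y g n : homA H ra g ->
  \sw_(y1, y2 <- Δ y) tens (twisted_contra actM gam g x (τ y1)) (actN y2 n) =
  twisted_contra actX gamX (coact_hom ra lam g n) x (τ y).
Proof.
move=> gP; have τP u := translation_takeuchi hopfH u.
have hP u := twisted_hom actMP actM_tgt gP x (τP u).
have CP := tensor_contra_coact_hom hopfH φP eP gamP lamP.
transitivity (\sw_(y1, y2 <- Δ y) gamX (coact_hom ra lam
    (fun w => \sw_(a, b <- τ y1) actM a (g (b * w * x))) (actN y2 n))).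
  by apply: eq_tlift => y1 y2; rewrite CP.
have XP := tensor_contra_contramodule hopfH φP eP gamP lamP.
rewrite -(contra_tlift XP); last first.
  move=> y1 y2; exact: coact_homP.
congr (gamX _); apply/funext => w.
have qP : homA H ra (fun z => g (z * (w * x))) by apply: homA_mulr.
transitivity (\sw_(y1, y2 <- Δ y) \sw_(v, n0 <- lam (actN y2 n))
  (tens (\sw_(a, b <- τ y1) actM a (g (b * v * (w * x)))) n0 : X)).
  apply: eq_tlift => y1 y2; apply: eq_tlift => v n0.
  by congr (tens _ n0); apply: eq_tlift => a b; rewrite !mulrA.
rewrite (twisted_YD qP); apply: eq_tlift => a b.
rewrite /coact_hom (morph_tlift _ _ (MtN_actDr a)); apply: eq_tlift => v n0.
rewrite MtN_act_tens; apply: eq_tlift => a1 a2.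
by rewrite !mulrA.
Qed.

Lemma tensor_contra_aYD u f : homA H xr f ->
  actX u (gamX f) = \sw_(u1, u2 <- Δ u) twisted_contra actX gamX f u1 (τ u2).
Proof.
have CD := tensor_contraD hopfH e φP gamP lamP.
have raP := contra_rmod gamP.
move: f; apply: (MtN_hom_ind lamP hopfH φP eP raP) => [g n gP|f f' _ _ IH IH'].
  rewrite (tensor_contra_coact_hom hopfH φP eP gamP lamP n gP) MtN_act_tens.
  pose T x y1 y2 : X :=
    tens (twisted_contra actM gam g x (τ y1)) (actN y2 n).
  have TP : trilinear H ls T.
    have [bl br ba] :=
      twisted_contra_balanced hopfH actMP actM_tgt gamP (aYD_lact aYDP) gP.
    split=> [y2|x]; split=> [v w w'|v w w'|v a w]; rewrite /T.
    - by rewrite bl tensDl.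
    - by rewrite br tensDl.
    - by rewrite ba.
    - by rewrite br tensDl.
    - by rewrite (lmodDl actNP) tensDr.
    - rewrite (twisted_contra_ract hopfH actMP actM_tgt gamP gP).
      by rewrite tensA actN_src.
  transitivity (\sw_(u1, u2 <- Δ u) \sw_(x, y <- Δ u1) T x y u2).
    apply: eq_tlift => u1 u2; rewrite aYD_twisted //.
    by rewrite tens_tliftl.
  rewrite (coact_assoc_sw _ (copr_comod H) TP); apply: eq_tlift => x y.
  exact: tensor_contra_twisted.
rewrite CD MtN_actDr IH IH' -tlift_split; apply: eq_tlift => x y.
rewrite /twisted_contra -CD; congr (gamX _); apply/funext => w.
by rewrite -tlift_split; apply: eq_tlift => a b; rewrite MtN_actDr.
Qed.

Lemma tensor_contra_aYD_contramodule : is_aYD_contramodule H actX xr gamX.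
Proof.
have XP := tensor_contra_contramodule hopfH φP eP gamP lamP.
have srcX a x : actX (s a) x = contra_lact H xr gamX a x.
  elim/tensor_ind: x => [m n|x y Ex Ey].
    rewrite (tensor_contra_lact hopfH φP eP gamP lamP) MtN_act_src.
    by rewrite (aYD_lact aYDP).
  rewrite (morphDB (MtN_actDr _)) Ex Ey.
  by rewrite (morphDB (tensor_contra_lactD hopfH e φP gamP lamP a)).
split=> //; [exact: MtN_act_lmodule | exact: MtN_act_tgt |].
move=> u f c fP cP cE; rewrite tensor_contra_aYD //.
by rewrite -(twisted_contra_copr hopfH MtN_act_lmodule MtN_act_tgt XP srcX fP φP
               eP cP cE).
Qed.

End TensorAct.

Theorem proposition4p8 (k : comPzRingType) (A U : algType k)
    (H : bialgebroid A U) :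
  left_hopf H ->
  finitely_generated (U_right H) ->
  projective (U_right H) ->
  (forall (M N : zmodType) (ra : M -> A -> M) (gam : (U -> M) -> M)
      (la : A -> N -> N) (lam : N -> UtN (tgt H) la),
    is_contramodule H ra gam ->
    is_comodule H lam ->
    exists gam' : (U -> tensor ra la) -> tensor ra la,
      is_tensor_contraaction H gam lam gam' /\
      is_contramodule H (MtN_ract H lam) gam') /\
  (forall (M N : zmodType) (actM : U -> M -> M) (ra : M -> A -> M)
      (gam : (U -> M) -> M) (actN : U -> N -> N) (la : A -> N -> N)
      (lam : N -> UtN (tgt H) la),
    is_aYD_contramodule H actM ra gam ->
    is_YD H actN lam ->
    exists gam' : (U -> tensor ra la) -> tensor ra la,
      is_tensor_contraaction H gam lam gam' /\
      is_aYD_contramodule H (MtN_act H actM actN) (MtN_ract H lam) gam').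
Proof.
move=> hopfH fgU prU; have [d [e [φ [φP eP]]]] := dual_basis fgU prU.
split=> [M N ra gam la lam gamP lamP|M N actM ra gam actN la lam aYDP YDP].
  exists (tensor_contra e φ gam lam).
  by split; [apply: tensor_contraP | apply: tensor_contra_contramodule].
have gamP := aYD_contra aYDP; have lamP := YD_comod YDP.
exists (tensor_contra e φ gam lam); split; first exact: tensor_contraP.
apply: tensor_contra_aYD_contramodule => //; first exact: aYD_lmod aYDP.
exact: aYD_ract aYDP.
Qed.
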